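(* For each of the calculi $\mathcal{F}_{2018}$, $\mathcal{F}^{-}_{2018}$, $\mathcal{M}'_{2018}$, $\mathcal{M}'^{-}_{2018}$ and $\mathcal{M}_{2018}$, the derivability problem restricted to its one-division fragment is algorithmically undecidable; here the one-division fragment consists of the sequents all of whose formulae are built from variables using only $/$, $!$, $\langle\rangle$ and $[]^{-1}$, possibly with brackets in the antecedent.
   Context: Formulae are built from a countable set of variables and $\mathbf1$ by $\backslash,/,\cdot,\wedge,\vee$ and the unary $\langle\rangle$, $[]^{-1}$, $!$. Calculi with stoups: a stoup is a finite multiset of formulae ($\varnothing$ empty); a tree term is a formula or $[\Xi]$; a meta-formula is $\zeta;\Gamma$ ($\zeta$ a stoup, $\Gamma$ a finite sequence of tree terms, empty $\Lambda$), $\varnothing;\Gamma$ written $\Gamma$; comma is concatenation / multiset union; sequents $\Xi\to C$; $\Xi(\Theta)$ designates an occurrence of a meta-formula $\Theta$ which is $\Xi$ itself or the content of a bracket $[\Theta]$ at any depth. Common rules: axioms $A\to A$, $\Lambda\to\mathbf1$; ($/L$) from $\zeta_1;\Gamma\to B$ and $\Xi(\zeta_2;\Delta_1,C,\Delta_2)\to D$ infer $\Xi(\zeta_1,\zeta_2;\Delta_1,C/B,\Gamma,\Delta_2)\to D$; ($/R$) from $\zeta;\Gamma,B\to C$ infer $\zeta;\Gamma\to C/B$; ($\backslash L$) from $\zeta_1;\Gamma\to A$ and $\Xi(\zeta_2;\Delta_1,C,\Delta_2)\to D$ infer $\Xi(\zeta_1,\zeta_2;\Delta_1,\Gamma,A\backslash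 C,\Delta_2)\to D$; ($\backslash R$) from $\zeta;A,\Gamma\to C$ infer $\zeta;\Gamma\to A\backslash C$; ($\cdot L$) from $\Xi(\zeta;\Delta_1,A,B,\Delta_2)\to D$ infer $\Xi(\zeta;\Delta_1,A\cdot B,\Delta_2)\to D$; ($\cdot R$) from $\zeta_1;\Delta\to A$, $\zeta_2;\Gamma\to B$ infer $\zeta_1,\zeta_2;\Delta,\Gamma\to A\cdot B$; ($\mathbf1L$) from $\Xi(\zeta;\Delta_1,\Delta_2)\to A$ infer $\Xi(\zeta;\Delta_1,\mathbf1,\Delta_2)\to A$; additive rules with context $\Xi(\zeta;\Delta_1,\cdot,\Delta_2)$ on the left and arbitrary $\Xi$ on the right; ($[]^{-1}L$) from $\Xi(\zeta;\Delta_1,A,\Delta_2)\to B$ infer $\Xi(\zeta;\Delta_1,[[]^{-1}A],\Delta_2)\to B$; ($[]^{-1}R$) from $[\Xi]\to A$ infer $\Xi\to[]^{-1}A$; ($\langle\rangle L$) from $\Xi(\zeta;\Delta_1,[A],\Delta_2)\to B$ infer $\Xi(\zeta;\Delta_1,\langle\rangle A,\Delta_2)\to B$; ($\langle\rangle R$) from $\Xi\to A$ infer $[\Xi]\to\langle\rangle A$; ($!L$) from $\Xi(\zeta,A;\Gamma_1,\Gamma_2)\to B$ infer $\Xi(\zeta;\Gamma_1,!A,\Gamma_2)\to B$; ($!P$) from $\Xi(\zeta;\Gamma_1,A,\Gamma_2)\to B$ infer $\Xi(\zeta,A;\Gamma_1,\Gamma_2)\to B$. $\mathcal{M}_{2018}$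 adds ($!R$) from $!A\to B$ infer $!A\to!B$ and ($!C$) from $\Xi(\zeta,A;\Gamma_1,[A;\Gamma_2],\Gamma_3)\to B$ infer $\Xi(\zeta,A;\Gamma_1,[[\Gamma_2]],\Gamma_3)\to B$. $\mathcal{M}'_{2018}$ adds ($!R'$) from $A;\Lambda\to B$ infer $A;\Lambda\to!B$ and ($!C'$) from $\Xi(\zeta,A;\Gamma_1,[\zeta',A;\Gamma_2],\Gamma_3)\to B$ infer $\Xi(\zeta,A;\Gamma_1,[[\zeta';\Gamma_2]],\Gamma_3)\to B$. $\mathcal{M}'^{-}_{2018}$ is $\mathcal{M}'_{2018}$ restricted to formulae without $\mathbf1$, without $\Lambda\to\mathbf1$ and $\mathbf1L$, with $\backslash R,/R$ only if $\Gamma\ne\Lambda$ or $\zeta\ne\varnothing$ and $!C'$ only if $\Gamma_2\ne\Lambda$ or $\zeta'\neq\varnothing$. Cut is not a rule of these. Stoup-free calculi: meta-formulae are finite sequences of tree terms; rules are the stoup-free versions of the common rules (drop all stoups), except $!L$ is: from $\Xi(\Delta_1,A,\Delta_2)\to C$ infer $\Xi(\Delta_1,!A,\Delta_2)\to C$; plus ($!P_1$) from $\Xi(\Delta_1,!A,\Phi,\Delta_2)\to C$ infer $\Xi(\Delta_1,\Phi,!A,\Delta_2)\to C$, ($!P_2$) the converse, and (cut) from $\Pi\to A$ and $\Xi(\Gamma_1,A,\Gamma_2)\to C$ infer $\Xi(\Gamma_1,\Pi,\Gamma_2)\to C$. $\mathcal{F}_{2018}$ adds ($!R$) from $!A\to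 B$ infer $!A\to!B$ and ($!C$) from $\Xi(!A,\Gamma_1,[!A,\Gamma_2],\Gamma_3)\to C$ infer $\Xi(!A,\Gamma_1,[[\Gamma_2]],\Gamma_3)\to C$. $\mathcal{F}^{-}_{2018}$ is $\mathcal{F}_{2018}$ restricted to formulae without $\mathbf1$, without $\Lambda\to\mathbf1$ and $\mathbf1L$, with $\backslash R,/R$ only if $\Gamma\neq\Lambda$, and $!C$ only if $\Gamma_2\ne\Lambda$. *)

(* Defs.v *)
From Stdlib Require Import Bool List Arith Permutation.
Import ListNotations.

Inductive formula : Type :=
| Var    : nat -> formula
| One    : formula
| Under  : formula -> formula -> formula  (* Under A C = A \ C *)
| Over   : formula -> formula -> formula  (* Over C B  = C / B *)
| Prod   : formula -> formula -> formula
| With   : formula -> formula -> formula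
| Plus   : formula -> formula -> formula
| Dia    : formula -> formula
| BoxInv : formula -> formula
| Bang   : formula -> formula.

(* Tree terms and meta-formulae (stoup ; sequence of tree terms).
   Stoups are multisets, represented by lists; derivability in the stoup
   calculi is closed under permutation of any stoup (rule M_stoup_perm). *)
Inductive tt : Type :=
| TF : formula -> tt
| TB : meta -> tt                          (* [ Xi ] *)
with meta : Type :=
| Meta : list formula -> list tt -> meta.

Record sequent : Type := Seq { ant : meta; suc : formula }.

(* One-hole contexts Xi( . ): the hole is Xi itself, or the content of a
   bracket at any depth. *)
Inductive ctx : Type :=
| Hole : ctx
| InBr : list formula -> list tt -> ctx -> list tt -> ctx.

Fixpoint plug (c : ctx) (m : meta) : meta :=
  match c with
  | Hole => m
  | InBr z l c' r => Meta z (l ++ TB (plug c' m) :: r)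
  end.

Fixpoint onefree (A : formula) : bool :=
  match A with
  | Var _ => true
  | One => false
  | Under A B | Over A B | Prod A B | With A B | Plus A B => onefree A && onefree B
  | Dia A | BoxInv A | Bang A => onefree A
  end.

(* Stoup-free calculi F_2018 (minus = false) and F^-_2018 (minus = true).
   Stoup-free meta-formulae are Meta [] Gamma. *)
Inductive derivF (minus : bool) : sequent -> Prop :=
| F_ax A : (minus = true -> onefree A = true) ->
    derivF minus (Seq (Meta [] [TF A]) A)
| F_one : minus = false -> derivF minus (Seq (Meta [] []) One)
| F_overL c Gam B D1 C D2 D :
    derivF minus (Seq (Meta [] Gam) B) ->
    derivF minus (Seq (plug c (Meta [] (D1 ++ TF C :: D2))) D) ->
    derivF minus (Seq (plug c (Meta [] (D1 ++ TF (Over C B) :: Gam ++ D2))) D)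
| F_overR Gam B C : (minus = true -> Gam <> []) ->
    derivF minus (Seq (Meta [] (Gam ++ [TF B])) C) ->
    derivF minus (Seq (Meta [] Gam) (Over C B))
| F_underL c Gam A D1 C D2 D :
    derivF minus (Seq (Meta [] Gam) A) ->
    derivF minus (Seq (plug c (Meta [] (D1 ++ TF C :: D2))) D) ->
    derivF minus (Seq (plug c (Meta [] (D1 ++ Gam ++ TF (Under A C) :: D2))) D)
| F_underR Gam A C : (minus = true -> Gam <> []) ->
    derivF minus (Seq (Meta [] (TF A :: Gam)) C) ->
    derivF minus (Seq (Meta [] Gam) (Under A C))
| F_prodL c D1 A B D2 D :
    derivF minus (Seq (plug c (Meta [] (D1 ++ TF A :: TF B :: D2))) D) ->
    derivF minus (Seq (plug c (Meta [] (D1 ++ TF (Prod A B) :: D2))) D)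
| F_prodR Del Gam A B :
    derivF minus (Seq (Meta [] Del) A) ->
    derivF minus (Seq (Meta [] Gam) B) ->
    derivF minus (Seq (Meta [] (Del ++ Gam)) (Prod A B))
| F_oneL c D1 D2 A : minus = false ->
    derivF minus (Seq (plug c (Meta [] (D1 ++ D2))) A) ->
    derivF minus (Seq (plug c (Meta [] (D1 ++ TF One :: D2))) A)
| F_withL1 c D1 A B D2 C :
    derivF minus (Seq (plug c (Meta [] (D1 ++ TF A :: D2))) C) ->
    derivF minus (Seq (plug c (Meta [] (D1 ++ TF (With A B) :: D2))) C)
| F_withL2 c D1 A B D2 C :
    derivF minus (Seq (plug c (Meta [] (D1 ++ TF B :: D2))) C) ->
    derivF minus (Seq (plug c (Meta [] (D1 ++ TF (With A B) :: D2))) C)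
| F_withR Gam A B :
    derivF minus (Seq (Meta [] Gam) A) ->
    derivF minus (Seq (Meta [] Gam) B) ->
    derivF minus (Seq (Meta [] Gam) (With A B))
| F_plusL c D1 A B D2 C :
    derivF minus (Seq (plug c (Meta [] (D1 ++ TF A :: D2))) C) ->
    derivF minus (Seq (plug c (Meta [] (D1 ++ TF B :: D2))) C) ->
    derivF minus (Seq (plug c (Meta [] (D1 ++ TF (Plus A B) :: D2))) C)
| F_plusR1 Gam A B :
    derivF minus (Seq (Meta [] Gam) A) ->
    derivF minus (Seq (Meta [] Gam) (Plus A B))
| F_plusR2 Gam A B :
    derivF minus (Seq (Meta [] Gam) B) ->
    derivF minus (Seq (Meta [] Gam) (Plus A B))
| F_boxL c D1 A D2 B :
    derivF minus (Seq (plug c (Meta [] (D1 ++ TF A :: D2))) B) ->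
    derivF minus (Seq (plug c (Meta [] (D1 ++ TB (Meta [] [TF (BoxInv A)]) :: D2))) B)
| F_boxR Gam A :
    derivF minus (Seq (Meta [] [TB (Meta [] Gam)]) A) ->
    derivF minus (Seq (Meta [] Gam) (BoxInv A))
| F_diaL c D1 A D2 B :
    derivF minus (Seq (plug c (Meta [] (D1 ++ TB (Meta [] [TF A]) :: D2))) B) ->
    derivF minus (Seq (plug c (Meta [] (D1 ++ TF (Dia A) :: D2))) B)
| F_diaR Gam A :
    derivF minus (Seq (Meta [] Gam) A) ->
    derivF minus (Seq (Meta [] [TB (Meta [] Gam)]) (Dia A))
| F_bangL c D1 A D2 C :
    derivF minus (Seq (plug c (Meta [] (D1 ++ TF A :: D2))) C) ->
    derivF minus (Seq (plug c (Meta [] (D1 ++ TF (Bang A) :: D2))) C)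
| F_bangP1 c D1 A Phi D2 C :
    derivF minus (Seq (plug c (Meta [] (D1 ++ TF (Bang A) :: Phi ++ D2))) C) ->
    derivF minus (Seq (plug c (Meta [] (D1 ++ Phi ++ TF (Bang A) :: D2))) C)
| F_bangP2 c D1 A Phi D2 C :
    derivF minus (Seq (plug c (Meta [] (D1 ++ Phi ++ TF (Bang A) :: D2))) C) ->
    derivF minus (Seq (plug c (Meta [] (D1 ++ TF (Bang A) :: Phi ++ D2))) C)
| F_cut c Pi A G1 G2 C : (minus = true -> onefree A = true) ->
    derivF minus (Seq (Meta [] Pi) A) ->
    derivF minus (Seq (plug c (Meta [] (G1 ++ TF A :: G2))) C) ->
    derivF minus (Seq (plug c (Meta [] (G1 ++ Pi ++ G2))) C)
| F_bangR A B :
    derivF minus (Seq (Meta [] [TF (Bang A)]) B) ->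
    derivF minus (Seq (Meta [] [TF (Bang A)]) (Bang B))
| F_bangC c A G1 G2 G3 C : (minus = true -> G2 <> []) ->
    derivF minus (Seq (plug c (Meta [] (TF (Bang A) :: G1 ++
                     TB (Meta [] (TF (Bang A) :: G2)) :: G3))) C) ->
    derivF minus (Seq (plug c (Meta [] (TF (Bang A) :: G1 ++
                     TB (Meta [] [TB (Meta [] G2)]) :: G3))) C).

Inductive mvar : Type := M2018 | M'2018 | M'm2018.

Inductive derivM (v : mvar) : sequent -> Prop :=
| M_ax A : (v = M'm2018 -> onefree A = true) ->
    derivM v (Seq (Meta [] [TF A]) A)
| M_one : v <> M'm2018 -> derivM v (Seq (Meta [] []) One)
| M_overL c z1 Gam B z2 D1 C D2 D :
    derivM v (Seq (Meta z1 Gam) B) ->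
    derivM v (Seq (plug c (Meta z2 (D1 ++ TF C :: D2))) D) ->
    derivM v (Seq (plug c (Meta (z1 ++ z2) (D1 ++ TF (Over C B) :: Gam ++ D2))) D)
| M_overR z Gam B C : (v = M'm2018 -> Gam <> [] \/ z <> []) ->
    derivM v (Seq (Meta z (Gam ++ [TF B])) C) ->
    derivM v (Seq (Meta z Gam) (Over C B))
| M_underL c z1 Gam A z2 D1 C D2 D :
    derivM v (Seq (Meta z1 Gam) A) ->
    derivM v (Seq (plug c (Meta z2 (D1 ++ TF C :: D2))) D) ->
    derivM v (Seq (plug c (Meta (z1 ++ z2) (D1 ++ Gam ++ TF (Under A C) :: D2))) D)
| M_underR z Gam A C : (v = M'm2018 -> Gam <> [] \/ z <> []) ->
    derivM v (Seq (Meta z (TF A :: Gam)) C) ->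
    derivM v (Seq (Meta z Gam) (Under A C))
| M_prodL c z D1 A B D2 D :
    derivM v (Seq (plug c (Meta z (D1 ++ TF A :: TF B :: D2))) D) ->
    derivM v (Seq (plug c (Meta z (D1 ++ TF (Prod A B) :: D2))) D)
| M_prodR z1 Del z2 Gam A B :
    derivM v (Seq (Meta z1 Del) A) ->
    derivM v (Seq (Meta z2 Gam) B) ->
    derivM v (Seq (Meta (z1 ++ z2) (Del ++ Gam)) (Prod A B))
| M_oneL c z D1 D2 A : v <> M'm2018 ->
    derivM v (Seq (plug c (Meta z (D1 ++ D2))) A) ->
    derivM v (Seq (plug c (Meta z (D1 ++ TF One :: D2))) A)
| M_withL1 c z D1 A B D2 C :
    derivM v (Seq (plug c (Meta z (D1 ++ TF A :: D2))) C) ->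
    derivM v (Seq (plug c (Meta z (D1 ++ TF (With A B) :: D2))) C)
| M_withL2 c z D1 A B D2 C :
    derivM v (Seq (plug c (Meta z (D1 ++ TF B :: D2))) C) ->
    derivM v (Seq (plug c (Meta z (D1 ++ TF (With A B) :: D2))) C)
| M_withR X A B :
    derivM v (Seq X A) -> derivM v (Seq X B) -> derivM v (Seq X (With A B))
| M_plusL c z D1 A B D2 C :
    derivM v (Seq (plug c (Meta z (D1 ++ TF A :: D2))) C) ->
    derivM v (Seq (plug c (Meta z (D1 ++ TF B :: D2))) C) ->
    derivM v (Seq (plug c (Meta z (D1 ++ TF (Plus A B) :: D2))) C)
| M_plusR1 X A B : derivM v (Seq X A) -> derivM v (Seq X (Plus A B))
| M_plusR2 X A B : derivM v (Seq X B) -> derivM v (Seq X (Plus A B))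
| M_boxL c z D1 A D2 B :
    derivM v (Seq (plug c (Meta z (D1 ++ TF A :: D2))) B) ->
    derivM v (Seq (plug c (Meta z (D1 ++ TB (Meta [] [TF (BoxInv A)]) :: D2))) B)
| M_boxR X A :
    derivM v (Seq (Meta [] [TB X]) A) -> derivM v (Seq X (BoxInv A))
| M_diaL c z D1 A D2 B :
    derivM v (Seq (plug c (Meta z (D1 ++ TB (Meta [] [TF A]) :: D2))) B) ->
    derivM v (Seq (plug c (Meta z (D1 ++ TF (Dia A) :: D2))) B)
| M_diaR X A :
    derivM v (Seq X A) -> derivM v (Seq (Meta [] [TB X]) (Dia A))
| M_bangL c z A G1 G2 B :
    derivM v (Seq (plug c (Meta (z ++ [A]) (G1 ++ G2))) B) ->
    derivM v (Seq (plug c (Meta z (G1 ++ TF (Bang A) :: G2))) B)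
| M_bangP c z G1 A G2 B :
    derivM v (Seq (plug c (Meta z (G1 ++ TF A :: G2))) B) ->
    derivM v (Seq (plug c (Meta (z ++ [A]) (G1 ++ G2))) B)
(* stoups are multisets: derivability is invariant under reordering a stoup *)
| M_stoup_perm c z z' G B :
    Permutation z z' ->
    derivM v (Seq (plug c (Meta z G)) B) ->
    derivM v (Seq (plug c (Meta z' G)) B)
| M_bangR A B : v = M2018 ->
    derivM v (Seq (Meta [] [TF (Bang A)]) B) ->
    derivM v (Seq (Meta [] [TF (Bang A)]) (Bang B))
| M_bangC c z A G1 G2 G3 B : v = M2018 ->
    derivM v (Seq (plug c (Meta (z ++ [A]) (G1 ++ TB (Meta [A] G2) :: G3))) B) ->
    derivM v (Seq (plug c (Meta (z ++ [A])
                    (G1 ++ TB (Meta [] [TB (Meta [] G2)]) :: G3))) B)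
| M_bangR' A B : v <> M2018 ->
    derivM v (Seq (Meta [A] []) B) ->
    derivM v (Seq (Meta [A] []) (Bang B))
| M_bangC' c z A G1 z' G2 G3 B : v <> M2018 ->
    (v = M'm2018 -> G2 <> [] \/ z' <> []) ->
    derivM v (Seq (plug c (Meta (z ++ [A]) (G1 ++ TB (Meta (z' ++ [A]) G2) :: G3))) B) ->
    derivM v (Seq (plug c (Meta (z ++ [A])
                    (G1 ++ TB (Meta [] [TB (Meta z' G2)]) :: G3))) B).

Fixpoint onediv (A : formula) : bool :=
  match A with
  | Var _ => true
  | Over C B => onediv C && onediv B
  | Bang A | Dia A | BoxInv A => onediv A
  | _ => false
  end.

Fixpoint all_tt (P : formula -> bool) (t : tt) : bool :=
  match t with
  | TF A => P A
  | TB m => all_meta P m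
  end
with all_meta (P : formula -> bool) (m : meta) : bool :=
  match m with
  | Meta z g =>
      forallb P z &&
      (fix go (l : list tt) : bool :=
         match l with nil => true | x :: r => all_tt P x && go r end) g
  end.

Definition in_fragment (s : sequent) : Prop :=
  all_meta onediv (ant s) = true /\ onediv (suc s) = true.

Fixpoint sfree_tt (t : tt) : bool :=
  match t with
  | TF _ => true
  | TB m => sfree_meta m
  end
with sfree_meta (m : meta) : bool :=
  match m with
  | Meta z g =>
      match z with nil => true | _ => false end &&
      (fix go (l : list tt) : bool :=
         match l with nil => true | x :: r => sfree_tt x && go r end) g
  end.

Definition stoup_free (s : sequent) : Prop := sfree_meta (ant s) = true.

Inductive prf : Type :=
| Zero : prf
| Succ : prf
| Proj : nat -> prf
| Comp : prf -> list prf -> prf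
| Prim : prf -> prf -> prf
| Mu   : prf -> prf.

Inductive eval : prf -> list nat -> nat -> Prop :=
| eZero v : eval Zero v 0
| eSucc x v : eval Succ (x :: v) (S x)
| eProj i v : i < length v -> eval (Proj i) v (nth i v 0)
| eComp f gs v ys y : evall gs v ys -> eval f ys y -> eval (Comp f gs) v y
| ePrim0 f g v y : eval f v y -> eval (Prim f g) (0 :: v) y
| ePrimS f g n v r y :
    eval (Prim f g) (n :: v) r -> eval g (n :: r :: v) y ->
    eval (Prim f g) (S n :: v) y
| eMu f v n :
    eval f (n :: v) 0 ->
    (forall m, m < n -> exists k, eval f (m :: v) (S k)) ->
    eval (Mu f) v n
with evall : list prf -> list nat -> list nat -> Prop :=
| elNil v : evall nil v nil
| elCons g gs v y ys : eval g v y -> evall gs v ys -> evall (g :: gs) v (y :: ys).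

Definition cpair (a b : nat) : nat := (a + b) * (a + b + 1) / 2 + b.

Fixpoint code_list {T} (f : T -> nat) (l : list T) : nat :=
  match l with nil => 0 | x :: r => S (cpair (f x) (code_list f r)) end.

Fixpoint code_f (A : formula) : nat :=
  match A with
  | Var n => cpair 0 n
  | One => cpair 1 0
  | Under A B => cpair 2 (cpair (code_f A) (code_f B))
  | Over A B => cpair 3 (cpair (code_f A) (code_f B))
  | Prod A B => cpair 4 (cpair (code_f A) (code_f B))
  | With A B => cpair 5 (cpair (code_f A) (code_f B))
  | Plus A B => cpair 6 (cpair (code_f A) (code_f B))
  | Dia A => cpair 7 (code_f A)
  | BoxInv A => cpair 8 (code_f A)
  | Bang A => cpair 9 (code_f A)
  end.

Fixpoint code_tt (t : tt) : nat :=
  match t with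
  | TF A => cpair 0 (code_f A)
  | TB m => cpair 1 (code_meta m)
  end
with code_meta (m : meta) : nat :=
  match m with
  | Meta z g =>
      cpair (code_list code_f z)
        ((fix go (l : list tt) : nat :=
            match l with nil => 0 | x :: r => S (cpair (code_tt x) (go r)) end) g)
  end.

Definition code (s : sequent) : nat := cpair (code_meta (ant s)) (code_f (suc s)).

Definition decidable_on (In D : sequent -> Prop) : Prop :=
  exists f : prf, forall s, In s ->
    (D s /\ eval f [code s] 1) \/ (~ D s /\ eval f [code s] 0).

Definition undecidable_on (In D : sequent -> Prop) : Prop := ~ decidable_on In D.

(* Main.v *)
Require Import Defs.
From Stdlib Require Import List Arith Lia Permutation Cantor.
Import ListNotations.

(** Hardness comes from Post normal systems, whose steps turn a word [u w] into
    [w v]. Each letter of a word is preceded by the token [<><>q]. Unfolded to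
    [[[q]]], a token lets bracketed contraction copy some [!A] into it; for
    [A = ([]^-1 B)/q] the resulting [[A, q]] collapses to [B] outside the bracket.
    With [B = (s/(s/v))/u], deriving [u, w -> s] reduces to deriving [w, v -> s],
    and [v] brings new tokens. At the end a single formula consumes every [!A].

    Conversely, all five calculi, cut included, are sound for the powerset model
    of a free monoid that erases brackets and interprets [!A] by the empty word
    when it belongs to [A]; reading [s] as the set of words from which the system
    can halt makes every rule formula contain the empty word.

    Partial recursive functions are computed by local rewriting of stack programs
    written on a ring, and a ring is a queue with rotation rules. The program is
    in the antecedent and its input in the succedent, so the code of the sequent
    is a recursive function of the code of the antecedent and the input; feeding
    a program the code of its own antecedent gives the diagonal argument. *)

(** * The bracket-erasing language model *)

(** Erasing brackets makes contraction trivial, and the only word of [!A] is empty,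
    hence central. *)
Fixpoint den {X} (V : nat -> list X -> Prop) (A : formula) (w : list X) : Prop :=
  match A with
  | Var n => V n w
  | One => w = []
  | Under A C => forall u, den V A u -> den V C (u ++ w)
  | Over C B => forall u, den V B u -> den V C (w ++ u)
  | Prod A B => exists u v, w = u ++ v /\ den V A u /\ den V B v
  | With A B => den V A w /\ den V B w
  | Plus A B => den V A w \/ den V B w
  | Dia A | BoxInv A => den V A w
  | Bang A => w = [] /\ den V A []
  end.

(** A stoup formula must have the empty word in its language and contributes no letters, just like
    [!A] in the sequence. *)
Fixpoint den_tt {X} (V : nat -> list X -> Prop) (t : tt) (w : list X) : Prop :=
  match t with
  | TF A => den V A w
  | TB m => den_meta V m w
  end
with den_meta {X} (V : nat -> list X -> Prop) (m : meta) (w : list X) : Prop :=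
  match m with
  | Meta z g =>
      Forall (fun A => den V A []) z /\
      (fix go (l : list tt) (w : list X) : Prop :=
         match l with
         | nil => w = []
         | x :: r => exists u v, w = u ++ v /\ den_tt V x u /\ go r v
         end) g w
  end.

Definition den_seq {X} (V : nat -> list X -> Prop) : list tt -> list X -> Prop :=
  fix go l w :=
    match l with
    | nil => w = []
    | x :: r => exists u v, w = u ++ v /\ den_tt V x u /\ go r v
    end.

Lemma den_metaE X (V : nat -> list X -> Prop) z g w :
  den_meta V (Meta z g) w <-> Forall (fun A => den V A []) z /\ den_seq V g w.
Proof. reflexivity. Qed.

Lemma den_seq_app X (V : nat -> list X -> Prop) g1 g2 w :
  den_seq V (g1 ++ g2) w <->
  exists u v, w = u ++ v /\ den_seq V g1 u /\ den_seq V g2 v.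
Proof.
  revert w; induction g1 as [|x g1 IH]; intros w; cbn; split.
  - intros H; exists [], w; auto.
  - intros (u & v & -> & -> & H); exact H.
  - intros (u & v & -> & Hx & H). apply IH in H as (u' & v' & -> & H1 & H2).
    exists (u ++ u'), v'; rewrite app_assoc; eauto 8.
  - intros (u & v & -> & (u1 & u2 & -> & Hx & H1) & H2).
    exists u1, (u2 ++ v); rewrite app_assoc; split; [easy|split; [easy|]].
    apply IH; eauto.
Qed.

(** The hole occurs once, so an alternative chosen there can be carried outwards through the
    brackets. Two alternatives are allowed for the sake of the left rule of [Plus]. *)
Lemma den_plug_or X (V : nat -> list X -> Prop) c m m1 m2 :
  (forall w, den_meta V m w -> den_meta V m1 w \/ den_meta V m2 w) ->
  forall w, den_meta V (plug c m) w ->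
    den_meta V (plug c m1) w \/ den_meta V (plug c m2) w.
Proof.
  intros H; induction c as [|z l c IH r]; cbn [plug]; [exact H|].
  intros w (Hz & Hw); change (den_seq V (l ++ TB (plug c m) :: r) w) in Hw.
  apply den_seq_app in Hw as (u & v & -> & Hu & u' & v' & -> & Hm & Hv).
  destruct (IH u' Hm); [left|right]; rewrite den_metaE, den_seq_app;
    split; auto; exists u, (u' ++ v'); cbn; eauto 8.
Qed.

Lemma den_plug X (V : nat -> list X -> Prop) c m m1 :
  (forall w, den_meta V m w -> den_meta V m1 w) ->
  forall w, den_meta V (plug c m) w -> den_meta V (plug c m1) w.
Proof. intros H w Hw; destruct (den_plug_or X V c m m1 m1) with w; auto. Qed.

Lemma den_seq_app_intro X (V : nat -> list X -> Prop) g1 g2 u v w :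
  den_seq V g1 u -> den_seq V g2 v -> w = u ++ v -> den_seq V (g1 ++ g2) w.
Proof. rewrite den_seq_app; eauto. Qed.

Lemma den_seq_cons_intro X (V : nat -> list X -> Prop) x g u v w :
  den_tt V x u -> den_seq V g v -> w = u ++ v -> den_seq V (x :: g) w.
Proof. cbn; eauto. Qed.

Lemma den_seq_cons X (V : nat -> list X -> Prop) x g w :
  den_seq V (x :: g) w <-> exists u v, w = u ++ v /\ den_tt V x u /\ den_seq V g v.
Proof. reflexivity. Qed.

Lemma den_seq_nil X (V : nat -> list X -> Prop) w : den_seq V [] w <-> w = [].
Proof. reflexivity. Qed.

Ltac den_elim :=
  repeat (cbn [app] in *;
    match goal with
    | H : _ /\ _ |- _ => destruct H
    | H : exists _, _ |- _ => destruct H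
    | H : ?w = [] |- _ => is_var w; subst w
    | H : ?w = _ ++ _ |- _ => is_var w; subst w
    | H : Forall _ (_ ++ _) |- _ => apply (proj1 (Forall_app _ _ _)) in H
    | H : Forall _ (_ :: _) |- _ => apply (proj1 (Forall_cons_iff _ _ _)) in H
    | H : den_meta _ (Meta _ _) _ |- _ => apply (proj1 (den_metaE _ _ _ _ _)) in H
    | H : den_seq _ (_ ++ _) _ |- _ => apply (proj1 (den_seq_app _ _ _ _ _)) in H
    | H : den_seq _ (_ :: _) _ |- _ => apply (proj1 (den_seq_cons _ _ _ _ _)) in H
    | H : den_seq _ [] _ |- _ => apply (proj1 (den_seq_nil _ _ _)) in H
    | H : den_tt ?V (TB ?m) ?w |- _ => change (den_meta V m w) in H
    | H : den_tt _ (TF _) _ |- _ => cbn [den_tt] in H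
    | H : den _ (Dia _) _ |- _ => cbn [den] in H
    | H : den _ (BoxInv _) _ |- _ => cbn [den] in H
    | H : den _ (Bang _) _ |- _ => cbn [den] in H
    | H : den _ One _ |- _ => cbn [den] in H
    | H : den _ (With _ _) _ |- _ => cbn [den] in H
    | H : den _ (Prod _ _) _ |- _ => cbn [den] in H
    end).

Ltac den_assoc :=
  rewrite <- ?app_assoc, ?app_nil_r; cbn [app];
  rewrite <- ?app_assoc, ?app_nil_r; reflexivity.

Ltac den_intro :=
  cbn [app];
  lazymatch goal with
  | |- den_meta _ (Meta _ _) _ =>
      apply (proj2 (den_metaE _ _ _ _ _)); split; [den_intro|den_intro]
  | |- Forall _ _ =>
      rewrite ?Forall_app, ?Forall_cons_iff; repeat split; auto; fail
  | |- den_seq _ [] _ => exact (eq_refl [])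
  | |- den_seq _ (_ ++ _) _ =>
      eapply den_seq_app_intro; [den_intro|den_intro|den_assoc]
  | |- den_seq _ (_ :: _) _ =>
      eapply den_seq_cons_intro; [den_intro|den_intro|den_assoc]
  | |- den_seq _ _ _ => eassumption
  | |- den_tt ?V (TB ?m) ?w => change (den_meta V m w); den_intro
  | |- den_tt _ (TF _) _ => cbn [den_tt]; den_intro
  | |- den _ (Bang _) _ => split; [reflexivity|eassumption]
  | |- den _ (Dia _) _ => cbn [den]; den_intro
  | |- den _ (BoxInv _) _ => cbn [den]; den_intro
  | |- _ => eassumption
  end.

(** By monotonicity of contexts, a left rule only has to be checked at the hole. *)
Ltac den_ctx :=
  match goal with
  | IH : forall w, den_meta _ (plug _ _) w -> _, H : den_meta _ (plug _ _) ?w |- _ =>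
      apply IH; clear IH; revert w H; apply den_plug; intros; den_elim
  end.

Theorem derivF_sound X (V : nat -> list X -> Prop) b s :
  derivF b s -> forall w, den_meta V (ant s) w -> den V (suc s) w.
Proof.
  induction 1; cbn [ant suc] in *; intros w Hw.
  (* Settles the one-premise left rules, among them permutation and contraction: [!A] has at most
     the empty word and brackets are invisible. *)
  all: try (den_ctx; den_intro; fail).
  - den_elim. rewrite app_nil_r; assumption.
  - den_elim. reflexivity.
  - den_ctx. match goal with
    | H : den V (Over C B) ?a, H' : den_seq V Gam ?b |- _ =>
        assert (den V C (a ++ b)) by (apply H, IHderivF1; den_intro)
    end.
    den_intro.
  - intros u Hu. apply IHderivF. den_elim. den_intro.
  - den_ctx. match goal with
    | H : den V (Under A C) ?a, H' : den_seq V Gam ?b |- _ =>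
        assert (den V C (b ++ a)) by (apply H, IHderivF1; den_intro)
    end.
    den_intro.
  - intros u Hu. apply IHderivF. den_elim. den_intro.
  - den_elim. exists x, x0; repeat split; [apply IHderivF1|apply IHderivF2]; den_intro.
  - split; auto.
  - apply den_plug_or with (m1 := Meta [] (D1 ++ TF A :: D2))
      (m2 := Meta [] (D1 ++ TF B :: D2)) in Hw as [Hw|Hw]; auto.
    intros v Hv; den_elim.
    match goal with H : den V (Plus _ _) _ |- _ => destruct H end; [left|right]; den_intro.
  - left; auto.
  - right; auto.
  - apply IHderivF. den_elim. den_intro.
  - den_elim. rewrite app_nil_r. apply IHderivF. den_intro.
  - den_ctx. assert (den V A x1) by (apply IHderivF1; den_intro). den_intro.
  - den_elim. split; [reflexivity|]. apply IHderivF. den_intro.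
Qed.

Theorem derivM_sound X (V : nat -> list X -> Prop) v s :
  derivM v s -> forall w, den_meta V (ant s) w -> den V (suc s) w.
Proof.
  induction 1; cbn [ant suc] in *; intros w Hw.
  all: try (den_ctx; den_intro; fail).
  - den_elim. rewrite app_nil_r; assumption.
  - den_elim. reflexivity.
  - den_ctx. match goal with
    | H : den V (Over C B) ?a, H' : den_seq V Gam ?b |- _ =>
        assert (den V C (a ++ b)) by (apply H, IHderivM1; den_intro)
    end.
    den_intro.
  - intros u Hu. apply IHderivM. den_elim. den_intro.
  - den_ctx. match goal with
    | H : den V (Under A C) ?a, H' : den_seq V Gam ?b |- _ =>
        assert (den V C (b ++ a)) by (apply H, IHderivM1; den_intro)
    end.
    den_intro.
  - intros u Hu. apply IHderivM. den_elim. den_intro.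
  - den_elim. exists x, x0; repeat split; [apply IHderivM1|apply IHderivM2]; den_intro.
  - split; auto.
  - apply den_plug_or with (m1 := Meta z (D1 ++ TF A :: D2))
      (m2 := Meta z (D1 ++ TF B :: D2)) in Hw as [Hw|Hw]; auto.
    intros u Hu; den_elim.
    match goal with H : den V (Plus _ _) _ |- _ => destruct H end; [left|right]; den_intro.
  - left; auto.
  - right; auto.
  - apply IHderivM. den_intro.
  - den_elim. rewrite app_nil_r. apply IHderivM. assumption.
  - den_ctx. apply (proj2 (den_metaE _ _ _ _ _)). split; [|assumption].
    match goal with H : Permutation _ _ |- _ => rewrite H; assumption end.
  - den_elim. split; [reflexivity|]. apply IHderivM. den_intro.
  - den_elim. split; [reflexivity|]. apply IHderivM. den_intro.
Qed.

(** * Simulating queue rewriting in the calculi *)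

(** The head of [Ys] is the outermost denominator, so [overs C Ys] followed by [Ys] in order reduces
    to [C]; this replaces division by a product. *)
Definition overs (C : formula) (Ys : list formula) : formula :=
  fold_right (fun Y K => Over K Y) C Ys.

(** The variables 0, 1, 2 are the goal [s] of a running word, the goal [t] of the
    final word, and the content [q] of a token. *)
Definition token : formula := Dia (Dia (Var 2)).
Definition letter_var (a : nat) : formula := Var (3 + a).
Definition letters (w : list nat) : list formula :=
  flat_map (fun a => [token; letter_var a]) w.

(** [Rule x u g v] rewrites [x u w] with goal [s] to [w v] with goal [g]; the
    left-hand side is nonempty because its first token is turned into the rule. *)
Record rule : Type := Rule { lhd : nat; ltl : list nat; tgt : nat; rhs : list nat }.

(** Steps start from goal 0 only, so a rule with target 1 must be the last one and must leave
    exactly [[0]]. *)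
Inductive accepts (R : list rule) : list nat -> nat -> Prop :=
| accepts_end : accepts R [0] 1
| accepts_step r w :
    In r R -> accepts R (w ++ rhs r) (tgt r) -> accepts R (lhd r :: ltl r ++ w) 0.

(** This is [(s/(g/v))/u] without the first token of [u], which is the token that turns into the
    formula. Proving [g/v] from the rest of the word appends [v] to it. *)
Definition action (r : rule) : formula :=
  overs (Over (Var 0) (overs (Var (tgt r)) (letters (rhs r))))
    (letter_var (lhd r) :: letters (ltl r)).
Definition rule_formula (r : rule) : formula := Over (BoxInv (action r)) (Var 2).
(** There is no weakening, so the end of a derivation uses up each rule formula.
    It takes [A] rather than [!A], because [!A] cannot be recovered from a stoup
    in M_2018 without cut. *)
Definition collector (R : list rule) : formula :=
  overs (Var 1) (letters [0] ++ map rule_formula R).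
Definition program (R : list rule) : list formula :=
  collector R :: map rule_formula R.
Definition bangs (Z : list formula) : list tt := map (fun A => TF (Bang A)) Z.

Lemma onediv_onefree A : onediv A = true -> onefree A = true.
Proof.
  induction A; cbn; intros H; try discriminate; auto.
  apply Bool.andb_true_iff in H as [? ?]; rewrite IHA1, IHA2; auto.
Qed.

Lemma overs_onediv C Ys :
  onediv C = true -> forallb onediv Ys = true -> onediv (overs C Ys) = true.
Proof.
  intros HC; induction Ys as [|Y Ys IH]; [easy|].
  cbn [forallb]; intros [HY HYs]%Bool.andb_true_iff.
  change (onediv (overs C Ys) && onediv Y = true)%bool. rewrite IH; auto.
Qed.

Lemma letters_onediv w : forallb onediv (letters w) = true.
Proof. induction w; cbn; auto. Qed.

Lemma rule_formula_onediv r : onediv (rule_formula r) = true.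
Proof.
  cbn. rewrite !overs_onediv; cbn; auto using letters_onediv.
  rewrite overs_onediv; auto using letters_onediv.
Qed.

Lemma program_onediv R : forallb onediv (program R) = true.
Proof.
  assert (H : forallb onediv (map rule_formula R) = true).
  { induction R; cbn [map forallb]; [easy|]. rewrite rule_formula_onediv; easy. }
  cbn [program forallb]. rewrite H, Bool.andb_true_r.
  apply overs_onediv; [easy|]. rewrite forallb_app, H; easy.
Qed.

Lemma letters_app u v : letters (u ++ v) = letters u ++ letters v.
Proof. apply flat_map_app. Qed.

(** * Derivations in the stoup-free calculi *)

Lemma F_bangP b D1 A Phi D2 C :
  derivF b (Seq (Meta [] (D1 ++ TF (Bang A) :: Phi ++ D2)) C) <->
  derivF b (Seq (Meta [] (D1 ++ Phi ++ TF (Bang A) :: D2)) C).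
Proof.
  split; [exact (F_bangP1 b Hole D1 A Phi D2 C)
         |exact (F_bangP2 b Hole D1 A Phi D2 C)].
Qed.

Lemma F_bangs_swap b Z D1 Phi D2 C :
  derivF b (Seq (Meta [] (D1 ++ bangs Z ++ Phi ++ D2)) C) <->
  derivF b (Seq (Meta [] (D1 ++ Phi ++ bangs Z ++ D2)) C).
Proof.
  revert D1; induction Z as [|A Z IH]; intros D1; cbn [bangs map app]; [easy|].
  rewrite <- F_bangP.
  specialize (IH (D1 ++ [TF (Bang A)])). rewrite <- !app_assoc in IH. exact IH.
Qed.

(** Contraction wants [!A] at the front of its meta-formula; this takes a chosen member of the
    program there and back. *)
Lemma F_bang_front b A Z1 Z2 Phi C :
  derivF b (Seq (Meta [] (TF (Bang A) :: Phi ++ bangs Z1 ++ bangs Z2)) C) <->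
  derivF b (Seq (Meta [] (Phi ++ bangs (Z1 ++ A :: Z2))) C).
Proof.
  pose proof (F_bangP b [] A (Phi ++ bangs Z1) (bangs Z2) C) as H.
  cbn [app] in H. rewrite <- !app_assoc in H.
  unfold bangs in *. rewrite map_app. exact H.
Qed.

(** The token becomes [[[q]]], then [[A, q]], then [[[]^-1 B]], then [B]. *)
Lemma F_land b r D1 D2 C :
  derivF b (Seq (Meta [] (TF (Bang (rule_formula r)) :: D1 ++ TF (action r) :: D2)) C) ->
  derivF b (Seq (Meta [] (TF (Bang (rule_formula r)) :: D1 ++ TF token :: D2)) C).
Proof.
  intros H. set (A := rule_formula r) in *.
  pose (c := InBr [] (TF (Bang A) :: D1) Hole D2).
  refine (F_diaL b Hole (TF (Bang A) :: D1) (Dia (Var 2)) D2 C _).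
  refine (F_diaL b c [] (Var 2) [] C _).
  refine (F_bangC b Hole A D1 [TF (Var 2)] D2 C _ _); [easy|].
  refine (F_bangL b c [] A [TF (Var 2)] C _).
  refine (F_overL b c [TF (Var 2)] (Var 2) [] (BoxInv (action r)) [] C _ _).
  - apply F_ax; easy.
  - exact (F_boxL b Hole (TF (Bang A) :: D1) (action r) D2 C H).
Qed.

Lemma F_oversL b K Ys Gs D1 D2 C :
  Forall2 (fun Y G => derivF b (Seq (Meta [] G) Y)) Ys Gs ->
  derivF b (Seq (Meta [] (D1 ++ TF K :: D2)) C) ->
  derivF b (Seq (Meta [] (D1 ++ TF (overs K Ys) :: concat Gs ++ D2)) C).
Proof.
  intros HY; revert D2; induction HY as [|Y G Ys Gs H HY IH]; intros D2 HK; [exact HK|].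
  cbn [concat overs fold_right]. rewrite <- app_assoc.
  apply (F_overL b Hole G Y D1 (overs K Ys) (concat Gs ++ D2) C H), IH, HK.
Qed.

Lemma F_oversL_ax b K Ys D1 D2 C :
  forallb onediv Ys = true ->
  derivF b (Seq (Meta [] (D1 ++ TF K :: D2)) C) ->
  derivF b (Seq (Meta [] (D1 ++ TF (overs K Ys) :: map TF Ys ++ D2)) C).
Proof.
  intros HY HK.
  replace (map TF Ys) with (concat (map (fun Y => [TF Y]) Ys)).
  - apply F_oversL; [|easy]. clear HK; induction Ys; cbn in *; constructor.
    + apply Bool.andb_true_iff in HY. apply F_ax; intros _; apply onediv_onefree, HY.
    + apply Bool.andb_true_iff in HY; apply IHYs, HY.
  - clear; induction Ys; cbn; congruence.
Qed.

(** [G <> []] is the side condition of [/R] in the restricted calculus; antecedents only grow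
    upwards, so it persists. *)
Lemma F_oversR b G K Ys :
  G <> [] ->
  derivF b (Seq (Meta [] (G ++ map TF Ys)) K) ->
  derivF b (Seq (Meta [] G) (overs K Ys)).
Proof.
  revert G; induction Ys as [|Y Ys IH]; cbn; intros G HG H.
  - rewrite app_nil_r in H; exact H.
  - apply F_overR; [easy|]. apply IH; [now destruct G|]. rewrite <- app_assoc; exact H.
Qed.

Lemma F_accepts b R w g :
  accepts R w g ->
  derivF b (Seq (Meta [] (map TF (letters w) ++ bangs (program R))) (Var g)).
Proof.
  induction 1 as [|r w Hr _ IH].
  - cbn [program bangs map].
    apply -> (F_bangP b [] (collector R) (map TF (letters [0])) (bangs (map rule_formula R))).
    refine (F_bangL b Hole [] (collector R) _ _ _).
    unfold collector.
    (* The antecedent is cut into singletons, one for each denominator of the collector: letters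
       match by axioms, and each [!A] proves its [A]. *)
    replace (map TF (letters [0]) ++ bangs (map rule_formula R)) with
      (concat (map (fun Y => [TF Y]) (letters [0]) ++
               map (fun A => [TF (Bang A)]) (map rule_formula R)) ++ []).
    + apply F_oversL with (D1 := []); [|now apply F_ax].
      apply Forall2_app; [repeat constructor; easy|].
      induction R as [|r R IHR]; cbn [map]; constructor; [|exact IHR].
      refine (F_bangL b Hole [] (rule_formula r) [] _ _).
      apply F_ax; intros _; apply onediv_onefree, rule_formula_onediv.
    + rewrite app_nil_r, concat_app. f_equal.
      induction R as [|r R IHR]; [easy|]. exact (f_equal (cons _) IHR).
  - assert (Hp : In (rule_formula r) (program R)) by (right; now apply in_map).
    apply in_split in Hp as (Z1 & Z2 & HZ).
    cbn [letters flat_map app map]. fold (letters (ltl r ++ w)).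
    rewrite HZ, app_comm_cons, app_comm_cons, <- F_bang_front.
    apply (F_land b r []).
    cbn [app].
    rewrite app_comm_cons, app_comm_cons, F_bang_front, <- HZ.
    rewrite letters_app, map_app, <- !app_comm_cons, <- app_assoc.
    set (Z := bangs (program R)) in *.
    unfold action. set (K := Over _ (overs _ _)).
    apply (F_oversL_ax b K (letter_var (lhd r) :: letters (ltl r)) []
             (map TF (letters w) ++ Z)).
    { exact (letters_onediv (ltl r)). }
    (* The argument of [K] takes everything to its right, program included. The right rules then put
       [v] behind the program, and the bangs are moved past it. *)
    pose proof (F_overL b Hole (map TF (letters w) ++ Z)
      (overs (Var (tgt r)) (letters (rhs r))) [] (Var 0) [] (Var 0)) as HK.
    rewrite app_nil_r in HK. apply HK; clear HK; [|now apply F_ax].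
    (* Even for empty [w] the antecedent contains the banged collector. *)
    apply F_oversR; [now destruct (map TF (letters w))|].
    rewrite letters_app, map_app, <- app_assoc in IH.
    pose proof (F_bangs_swap b (program R) (map TF (letters w))
      (map TF (letters (rhs r))) [] (Var (tgt r))) as Hs.
    rewrite !app_nil_r in Hs. rewrite <- app_assoc. apply Hs, IH.
Qed.

(** * Derivations in the stoup calculi *)

Lemma M_land v r z D1 D2 C :
  derivM v (Seq (Meta (z ++ [rule_formula r]) (D1 ++ TF (action r) :: D2)) C) ->
  derivM v (Seq (Meta (z ++ [rule_formula r]) (D1 ++ TF token :: D2)) C).
Proof.
  intros H. set (A := rule_formula r) in *.
  pose (c := InBr (z ++ [A]) D1 Hole D2).
  refine (M_diaL v Hole (z ++ [A]) D1 (Dia (Var 2)) D2 C _).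
  refine (M_diaL v c [] [] (Var 2) [] C _).
  assert (Hc : derivM v (Seq (plug Hole (Meta (z ++ [A])
                 (D1 ++ TB (Meta [A] [TF (Var 2)]) :: D2))) C)).
  { refine (M_bangP v c [] [] A [TF (Var 2)] C _).
    refine (M_overL v c [] [TF (Var 2)] (Var 2) [] [] (BoxInv (action r)) [] C _ _).
    - apply M_ax; easy.
    - exact (M_boxL v Hole (z ++ [A]) D1 (action r) D2 C H). }
  (* With [z'] empty, [!C'] has the shape of [!C]; the [q] in the bracket meets the side condition
     of the restricted calculus. *)
  destruct v.
  - now apply (M_bangC M2018 Hole z A D1 [TF (Var 2)] D2 C).
  - now apply (M_bangC' M'2018 Hole z A D1 [] [TF (Var 2)] D2 C).
  - apply (M_bangC' M'm2018 Hole z A D1 [] [TF (Var 2)] D2 C); [easy| |exact Hc].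
    now left.
Qed.

Lemma M_oversL v K Ys zGs z D1 D2 C :
  Forall2 (fun Y zG => derivM v (Seq (Meta (fst zG) (snd zG)) Y)) Ys zGs ->
  derivM v (Seq (Meta z (D1 ++ TF K :: D2)) C) ->
  derivM v (Seq (Meta (concat (map fst zGs) ++ z)
                   (D1 ++ TF (overs K Ys) :: concat (map snd zGs) ++ D2)) C).
Proof.
  intros HY; revert D2; induction HY as [|Y G Ys Gs H HY IH]; intros D2 HK; [exact HK|].
  cbn [concat map overs fold_right]. rewrite <- !app_assoc.
  apply (M_overL v Hole _ _ Y _ D1 (overs K Ys) (concat (map snd Gs) ++ D2) C H), IH, HK.
Qed.

(** Here the side condition of [/R] is met by the stoup, which holds the program even when the word
    is empty. *)
Lemma M_oversR v z G K Ys :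
  z <> [] ->
  derivM v (Seq (Meta z (G ++ map TF Ys)) K) ->
  derivM v (Seq (Meta z G) (overs K Ys)).
Proof.
  intros Hz; revert G; induction Ys as [|Y Ys IH]; cbn; intros G H.
  - rewrite app_nil_r in H; exact H.
  - apply M_overR; [now right|]. apply IH. rewrite <- app_assoc; exact H.
Qed.

Lemma M_perm v z z' G C :
  Permutation z z' -> derivM v (Seq (Meta z G) C) -> derivM v (Seq (Meta z' G) C).
Proof. exact (M_stoup_perm v Hole z z' G C). Qed.

Lemma letters_axioms v Ys :
  forallb onediv Ys = true ->
  Forall2 (fun Y zG => derivM v (Seq (Meta (fst zG) (snd zG)) Y)) Ys
    (map (fun Y => ([], [TF Y])) Ys).
Proof.
  induction Ys as [|Y Ys IH]; cbn; constructor; apply Bool.andb_true_iff in H.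
  - apply M_ax; intros _; apply onediv_onefree, H.
  - apply IH, H.
Qed.

Lemma M_accepts v R w g :
  accepts R w g ->
  derivM v (Seq (Meta (program R) (map TF (letters w))) (Var g)).
Proof.
  induction 1 as [|r w Hr _ IH].
  (* [!P] acts on the last stoup formula, so the collector is rotated there. *)
  - apply M_perm with (z := map rule_formula R ++ [collector R]).
    { apply Permutation_app_comm. }
    refine (M_bangP v Hole _ [] (collector R) _ _ _).
    (* Each rule formula is proved from itself in a stoup of its own; together these stoups use up
       the program. *)
    pose proof (M_oversL v (Var 1) (letters [0] ++ map rule_formula R)
      (map (fun Y => ([], [TF Y])) (letters [0]) ++
       map (fun A => ([A], [])) (map rule_formula R)) [] [] [] (Var 1)) as H.
    rewrite !map_app, !concat_app, !app_nil_r in H.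
    replace (concat (map fst (map (fun A => ([A], @nil tt)) (map rule_formula R))))
      with (map rule_formula R) in H
      by (clear; induction R as [|r R IH]; [easy|exact (f_equal (cons _) IH)]).
    replace (concat (map snd (map (fun A => ([A], @nil tt)) (map rule_formula R))))
      with (@nil tt) in H
      by (clear; induction R as [|r R IH]; [easy|exact IH]).
    apply H; [|now apply M_ax].
    apply Forall2_app; [now apply letters_axioms|].
    clear; induction R as [|r R IHR]; cbn [map]; constructor; [|exact IHR].
    refine (M_bangP v Hole [] [] (rule_formula r) [] _ _).
    apply M_ax; intros _; apply onediv_onefree, rule_formula_onediv.
  - assert (Hp : In (rule_formula r) (program R)) by (right; now apply in_map).
    apply in_split in Hp as (Z1 & Z2 & HZ).
    assert (HP : Permutation (program R) ((Z1 ++ Z2) ++ [rule_formula r])).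
    { rewrite HZ, <- app_assoc. apply Permutation_app_head, Permutation_cons_append. }
    cbn [letters flat_map app map]. fold (letters (ltl r ++ w)).
    apply (M_perm v _ _ _ _ (Permutation_sym HP)).
    apply (M_land v r _ []). apply (M_perm v _ _ _ _ HP). cbn [app].
    unfold action. set (K := Over _ (overs _ _)).
    pose proof (M_oversL v K (letter_var (lhd r) :: letters (ltl r))
      (map (fun Y => ([], [TF Y])) (letter_var (lhd r) :: letters (ltl r)))
      (program R) [] (map TF (letters w)) (Var 0)) as H.
    replace (concat (map fst _)) with (@nil formula) in H
      by (symmetry; generalize (letter_var (lhd r) :: letters (ltl r)); clear;
          intros l; induction l as [|Y l IH]; [easy|exact IH]).
    replace (concat (map snd _)) with (map TF (letter_var (lhd r) :: letters (ltl r))) in H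
      by (symmetry; generalize (letter_var (lhd r) :: letters (ltl r)); clear;
          intros l; induction l as [|Y l IH]; [easy|exact (f_equal (cons _) IH)]).
    rewrite letters_app, map_app. apply H; clear H.
    { apply letters_axioms, letters_onediv with (w := lhd r :: ltl r). }
    pose proof (M_overL v Hole (program R) (map TF (letters w))
      (overs (Var (tgt r)) (letters (rhs r))) [] [] (Var 0) [] (Var 0)) as HK.
    rewrite !app_nil_r in HK. apply HK; clear HK; [|now apply M_ax].
    apply M_oversR; [easy|].
    rewrite letters_app, map_app in IH. exact IH.
Qed.

(** * Compiling partial recursive functions to stack rewriting *)

Fixpoint prf_nested_ind (P : prf -> Prop) (hz : P Zero) (hs : P Succ)
    (hp : forall i, P (Proj i)) (hc : forall f gs, P f -> Forall P gs -> P (Comp f gs))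
    (hr : forall f g, P f -> P g -> P (Prim f g)) (hm : forall f, P f -> P (Mu f))
    (f : prf) : P f :=
  let rec := prf_nested_ind P hz hs hp hc hr hm in
  match f with
  | Zero => hz
  | Succ => hs
  | Proj i => hp i
  | Comp f gs =>
      hc f gs (rec f)
        ((fix go l : Forall P l :=
            match l with
            | nil => Forall_nil P
            | g :: l => Forall_cons g (rec g) (go l)
            end) gs)
  | Prim f g => hr f g (rec f) (rec g)
  | Mu f => hm f (rec f)
  end.

Lemma eval_fun f : forall v y y', eval f v y -> eval f v y' -> y = y'.
Proof.
  induction f as [| |i|f gs IHf IHgs|f g IHf IHg|f IHf] using prf_nested_ind;
    intros v y y' H H'.
  - inversion H; inversion H'; congruence.
  - inversion H; inversion H'; congruence.
  - inversion H; inversion H'; congruence.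
  - inversion H as [| | |? ? ? ys ? Hg Hf| | |]; subst.
    inversion H' as [| | |? ? ? ys' ? Hg' Hf'| | |]; subst.
    assert (ys = ys') as ->; [|eauto].
    clear - IHgs Hg Hg'. revert ys ys' Hg Hg'.
    induction IHgs as [|g gs IH _ IHgs]; intros; inversion Hg; inversion Hg'; subst;
      [easy|f_equal; eauto].
  - destruct v as [|n v]; [inversion H|]. revert y y' H H'.
    induction n as [|n IHn]; intros; inversion H; inversion H'; subst; [eauto|].
    assert (r = r0) as -> by eauto. eauto.
  - inversion H as [| | | | | |? ? ? H0 Hlt]; subst.
    inversion H' as [| | | | | |? ? ? H0' Hlt']; subst.
    (* The smaller of two distinct results would be a zero and, by minimality of the larger, also a
       non-zero. *)
    destruct (lt_eq_lt_dec y y') as [[Hy|Hy]|Hy]; [|exact Hy|].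
    + destruct (Hlt' y Hy) as [k Hk]. discriminate (IHf _ _ _ H0 Hk).
    + destruct (Hlt y' Hy) as [k Hk]. discriminate (IHf _ _ _ H0' Hk).
Qed.

(** A word of operations acts on a stack of numbers from right to left: [Inc]
    increments the top, [Push] pushes 0, [Inc1] increments the second entry, [Ins1]
    inserts 0 below the top, [Pick i] copies and [Del i] deletes the [i]-th entry.
    [Fn f ds] pushes the value of [f] at the entries with indices [ds]. The words
    of [Inc] and [Push] are the stacks themselves, in unary. *)
Inductive op : Type :=
| Inc | Push | Inc1 | Ins1
| Pick (i : nat) | Del (i : nat)
| Fn (f : prf) (ds : list nat)
| LoopP (f g : prf) (ds : list nat)
| LoopM (f : prf) (ds : list nat)
| TestM (f : prf) (ds : list nat).

(** [(h, t, v)] rewrites [h :: t] to [v]. The stack stands to the right of an operation, so [t] is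
    at most the next symbol of its top entry. *)
Definition oprule : Type := (op * list op * list op)%type.

Definition base_rules : list oprule :=
  [ (Inc1, [Inc], [Inc; Inc1]); (Inc1, [Push], [Push; Inc]);
    (Ins1, [Inc], [Inc; Ins1]); (Ins1, [Push], [Push; Push]) ].

(** Symbols in front of the wanted entry are taken off and later restored below the copy, by [Inc1]
    and [Ins1]. *)
Fixpoint pick_rules (i : nat) : list oprule :=
  match i with
  | 0 => [ (Pick 0, [Inc], [Inc; Inc1; Pick 0]); (Pick 0, [Push], [Push; Push]) ]
  | S j => (Pick i, [Inc], [Inc1; Pick i]) :: (Pick i, [Push], [Ins1; Pick j])
             :: pick_rules j
  end.

Fixpoint del_rules (i : nat) : list oprule :=
  match i with
  | 0 => [ (Del 0, [Inc], [Del 0]); (Del 0, [Push], []) ]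
  | S j => (Del i, [Inc], [Inc; Del i]) :: (Del i, [Push], [Push; Del j])
             :: del_rules j
  end.

(** Words act from the right, so the head of [gs] is evaluated first; its value shifts the indices
    for the others by one. *)
Fixpoint args (gs : list prf) (ds : list nat) : list op :=
  match gs with
  | nil => nil
  | g :: gs => args gs (map S ds) ++ [Fn g ds]
  end.

(** The last value is on top, whence the reversed indices; [Del 1] then removes the values from
    under the result. *)
Definition comp_word (f : prf) (gs : list prf) (ds : list nat) : list op :=
  repeat (Del 1) (length gs) ++ Fn f (rev (seq 0 (length gs))) :: args gs ds.

(** On [r :: i :: a :: s] these point to [i], to [a] and to the parameters in [s]. *)
Definition prim_args (ds : list nat) : list nat := 1 :: 2 :: map (fun d => 3 + d) ds.

(** [LoopP] runs on a stack [r :: i :: a :: s] where [a] is the value at [i] and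
    [r] is the number of remaining iterations. *)
Definition prim_step (f g : prf) (ds : list nat) : list op :=
  [LoopP f g ds; Del 3; Del 3; Pick 2; Inc; Pick 2; Del 3; Fn g (prim_args ds)].

(** Index lists are part of the operations, so finitely many rules suffice for [Fn f ds]. [Succ],
    [Proj] and [Prim] without the argument they read get none, as they have no value. *)
Fixpoint prf_rules (f : prf) (ds : list nat) : list oprule :=
  match f with
  | Zero => [ (Fn f ds, [], [Push]) ]
  | Succ =>
      match ds with
      | nil => nil
      | d :: _ => (Fn f ds, [], [Inc; Pick d]) :: pick_rules d
      end
  | Proj i =>
      if i <? length ds
      then (Fn f ds, [], [Pick (nth i ds 0)]) :: pick_rules (nth i ds 0)
      else nil
  | Comp h gs =>
      (Fn f ds, [], comp_word h gs ds) :: del_rules 1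
        ++ prf_rules h (rev (seq 0 (length gs)))
        ++ (fix go gs ds :=
              match gs with
              | nil => nil
              | g :: gs => prf_rules g ds ++ go gs (map S ds)
              end) gs ds
  | Prim h g =>
      match ds with
      | nil => nil
      | d :: ds' =>
          (Fn f ds, [], [LoopP h g ds'; Pick (2 + d); Push; Fn h ds'])
            :: (LoopP h g ds', [Push], [Del 0])
            :: (LoopP h g ds', [Inc], prim_step h g ds')
            :: pick_rules (2 + d) ++ pick_rules 2 ++ del_rules 0 ++ del_rules 3
            ++ prf_rules h ds' ++ prf_rules g (prim_args ds')
      end
  | Mu h =>
      (Fn f ds, [], [LoopM h ds; Push])
        :: (LoopM h ds, [], [TestM h ds; Fn h (0 :: map S ds)])
        :: (TestM h ds, [Push], [])
        :: (TestM h ds, [Inc], [LoopM h ds; Inc; Del 0])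
        :: del_rules 0 ++ prf_rules h (0 :: map S ds)
  end.

(** * Relational semantics of stack programs and soundness of the rules *)

Definition select (s ds : list nat) : list nat := map (fun i => nth i s 0) ds.

Definition incr (s : list nat) : list nat :=
  match s with nil => nil | x :: r => S x :: r end.

(** The loop operations are specified by what their final result must satisfy, given
    their invariant; this makes every rule sound locally. *)
Definition op_rel (o : op) (s s' : list nat) : Prop :=
  match o with
  | Inc => s' = incr s
  | Push => s' = 0 :: s
  | Inc1 => s' = match s with nil => nil | x :: r => x :: incr r end
  | Ins1 => s' = match s with nil => nil | x :: r => x :: 0 :: r end
  | Pick i => i < length s /\ s' = nth i s 0 :: s
  | Del i => i < length s /\ s' = firstn i s ++ skipn (S i) s
  | Fn f ds => exists y, s' = y :: s /\ eval f (select s ds) y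
  | LoopP f g ds =>
      forall r i a b, s = r :: i :: a :: b -> exists y, s' = y :: b /\
        (eval (Prim f g) (i :: select b ds) a ->
         eval (Prim f g) (r + i :: select b ds) y)
  | LoopM f ds =>
      forall i b, s = i :: b -> exists y, s' = y :: b /\
        ((forall m, m < i -> exists k, eval f (m :: select b ds) (S k)) ->
         eval (Mu f) (select b ds) y)
  | TestM f ds =>
      forall z i b, s = z :: i :: b -> exists y, s' = y :: b /\
        (eval f (i :: select b ds) z ->
         (forall m, m < i -> exists k, eval f (m :: select b ds) (S k)) ->
         eval (Mu f) (select b ds) y)
  end.

Fixpoint word_rel (w : list op) (s s' : list nat) : Prop :=
  match w with
  | nil => s' = s
  | o :: w => exists m, word_rel w s m /\ op_rel o m s'
  end.

Lemma word_rel_app u w s s' :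
  word_rel (u ++ w) s s' <-> exists m, word_rel w s m /\ word_rel u m s'.
Proof.
  revert s'; induction u as [|o u IH]; cbn; intros s'; split.
  - eauto.
  - intros (m & H & ->); exact H.
  - intros (m & (m' & H & H')%IH & Ho); eauto.
  - intros (m' & H & m & H' & Ho); exists m; rewrite IH; eauto.
Qed.

(** Results are transported backwards along a run, from the rewritten word to the original one. *)
Definition oprule_sound (r : oprule) : Prop :=
  forall s s', word_rel (snd r) s s' -> word_rel (fst (fst r) :: snd (fst r)) s s'.

Ltac word_elim :=
  repeat (cbn [fst snd word_rel op_rel] in *;
    match goal with
    | H : exists _, _ |- _ => destruct H
    | H : _ /\ _ |- _ => destruct H
    | H : ?x = _ |- _ => is_var x; subst x
    | H : _ = ?x |- _ => is_var x; subst x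
    end).

Ltac loop_elim y Hy :=
  match goal with
  | H : forall _ : nat, _ |- _ => edestruct H as (y & -> & Hy); [reflexivity|]
  end.

Lemma base_rules_sound : Forall oprule_sound base_rules.
Proof.
  repeat constructor; intros s s' H; word_elim.
  - exists (incr s); split; [eauto|]. now destruct s as [|x [|y s]].
  - exists (0 :: s); split; eauto.
  - exists (incr s); split; [eauto|]. now destruct s as [|x [|y s]].
  - exists (0 :: s); split; eauto.
Qed.

Lemma pick_rules_sound i : Forall oprule_sound (pick_rules i).
Proof.
  induction i as [|i IH]; cbn [pick_rules]; repeat apply Forall_cons; auto;
    intros s s' H; word_elim.
  - exists (incr s); split; [eauto|]. destruct s as [|x s]; cbn in *; [lia|easy].
  - exists (0 :: s); split; [eauto|]. cbn; split; [lia|easy].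
  - exists (incr s); split; [eauto|]. destruct s as [|x s]; cbn in *; [lia|easy].
  - exists (0 :: s); split; [eauto|]. cbn in *; split; [lia|easy].
Qed.

Lemma del_rules_sound i : Forall oprule_sound (del_rules i).
Proof.
  induction i as [|i IH]; cbn [del_rules]; repeat apply Forall_cons; auto;
    intros s s' H; word_elim.
  - exists (incr s); split; [eauto|]. destruct s as [|x s]; cbn in *; [lia|easy].
  - exists (0 :: s); split; [eauto|]. cbn; split; [lia|easy].
  - exists (incr s); split; [eauto|]. destruct s as [|x s]; cbn in *; [lia|easy].
  - exists (0 :: s); split; [eauto|]. cbn in *; split; [lia|easy].
Qed.

Lemma args_rel gs ds s m :
  word_rel (args gs ds) s m ->
  exists ys, m = rev ys ++ s /\ evall gs (select s ds) ys.
Proof.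
  revert ds s; induction gs as [|g gs IH]; intros ds s; cbn [args].
  - intros ->; exists []; repeat constructor.
  - rewrite word_rel_app. cbn. intros (m' & (m0 & -> & y & -> & Hy) & H).
    apply IH in H as (ys & -> & Hys). exists (y :: ys); cbn.
    rewrite <- app_assoc; split; [easy|]. constructor; [easy|].
    unfold select in *; rewrite map_map in Hys; exact Hys.
Qed.

Lemma evall_length gs v ys : evall gs v ys -> length ys = length gs.
Proof. induction 1; cbn; congruence. Qed.

Lemma select_rev_seq ys s : select (rev ys ++ s) (rev (seq 0 (length ys))) = ys.
Proof.
  unfold select; rewrite map_rev.
  transitivity (rev (rev ys)); [f_equal|apply rev_involutive].
  rewrite <- (length_rev ys). generalize (rev ys) as l; clear.
  intros l; revert s; induction l as [|x l IH]; intros s; [easy|].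
  cbn [length seq map app nth]. f_equal. rewrite <- seq_shift, map_map. apply IH.
Qed.

Lemma del_prefix_rel l y s s' :
  word_rel (repeat (Del 1) (length l)) (y :: l ++ s) s' -> s' = y :: s.
Proof.
  (* The leftmost deletion acts last and removes the last entry of [l], hence induction from the
     right. *)
  revert y s s'; induction l as [|x l IH] using rev_ind; intros y s s'.
  - intros ->; easy.
  - rewrite length_app, Nat.add_comm. cbn [length Nat.add repeat word_rel].
    intros (m & H & Hd). rewrite <- app_assoc in H. apply IH in H as ->.
    cbn in Hd. easy.
Qed.

Lemma prf_rules_sound f ds : Forall oprule_sound (prf_rules f ds).
Proof.
  revert ds; induction f as [| |i|f gs IHf IHgs|f g IHf IHg|f IHf] using prf_nested_ind;
    intros ds; cbn [prf_rules].
  - repeat constructor; intros s s' H; word_elim.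
    eexists; split; [reflexivity|]. eexists; split; [reflexivity|constructor].
  - destruct ds as [|d ds]; [constructor|]. constructor; [|apply pick_rules_sound].
    intros s s' H; word_elim. eexists; split; [reflexivity|].
    eexists; split; [reflexivity|constructor].
  - destruct (Nat.ltb_spec i (length ds)); constructor; [|apply pick_rules_sound].
    intros s s' Hs; word_elim. eexists; split; [reflexivity|].
    eexists; split; [reflexivity|].
    replace (nth (nth i ds 0) s 0) with (nth i (select s ds) 0).
    + constructor. unfold select; now rewrite length_map.
    (* [map_nth] wants the default to be the image of 0 under the mapped function. *)
    + unfold select. rewrite nth_indep with (d' := nth 0 s 0) by (now rewrite length_map).
      apply (map_nth (fun i => nth i s 0)).
  - constructor.
    + intros s s' H. cbn [fst snd] in *. unfold comp_word in H.
      rewrite word_rel_app in H. destruct H as (m & H & Hd).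
      cbn [word_rel] in H. destruct H as (m' & H & Hf).
      apply args_rel in H as (ys & -> & Hys). cbn [op_rel] in Hf. destruct Hf as (y & -> & Hf).
      pose proof (evall_length _ _ _ Hys) as Hl. rewrite <- Hl in *.
      rewrite select_rev_seq in Hf. rewrite <- (length_rev ys) in Hd.
      apply del_prefix_rel in Hd as ->.
      eexists; split; [reflexivity|]. eexists; split; [reflexivity|]. econstructor; eauto.
    + rewrite !Forall_app; repeat split; auto using del_rules_sound.
      revert ds; induction IHgs as [|g gs Hg _ IH]; intros ds; [constructor|].
      rewrite Forall_app; auto.
  - destruct ds as [|d ds]; [constructor|].
    apply Forall_cons; [|apply Forall_cons; [|apply Forall_cons]].
    1-3: intros s s' H.
    + word_elim. loop_elim y Hy.
      eexists; split; [reflexivity|]. eexists; split; [reflexivity|].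
      cbn in *. rewrite Nat.add_0_r in *. apply Hy. now constructor.
    + word_elim. eexists; split; [eexists; split; reflexivity|].
      intros r i a b [= <- ->]. eexists; split; [reflexivity|]. easy.
    + cbn [fst snd word_rel op_rel]. eexists; split; [eexists; split; reflexivity|].
      intros r i a b Hs. destruct s as [|r' s]; [easy|]. injection Hs as <- ->.
      cbn [fst snd word_rel op_rel prim_step] in H. word_elim.
      cbn [firstn skipn app nth incr] in *.
      loop_elim y Hy. exists y; split; [easy|].
      (* An iteration moves one unit from the remaining count to the index; their sum stays the
         recursion argument. *)
      intros Ha. replace (S r' + i) with (r' + S i) by lia. apply Hy.
      econstructor; [exact Ha|].
      match goal with H : eval g _ _ |- _ =>
        unfold select, prim_args in H; cbn in H; rewrite map_map in H; exact H end.
    + rewrite !Forall_app; repeat split; auto using del_rules_sound, pick_rules_sound.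
  - apply Forall_cons; [|apply Forall_cons; [|apply Forall_cons; [|apply Forall_cons]]].
    1-4: intros s s' H.
    + word_elim. loop_elim y Hy. eexists; split; [reflexivity|].
      eexists; split; [reflexivity|]. apply Hy; lia.
    + word_elim. eexists; split; [reflexivity|]. intros i b ->.
      loop_elim y Hy. exists y; split; [easy|].
      apply Hy. unfold select in *; cbn in *. rewrite map_map in *. easy.
    + word_elim. eexists; split; [eexists; split; reflexivity|].
      intros z i b [= <- ->]. exists i; split; [easy|]. intros; now constructor.
    + word_elim. eexists; split; [eexists; split; reflexivity|].
      intros z i b Hs. destruct s as [|z' s]; [easy|]. injection Hs as <- ->.
      cbn [incr firstn skipn app] in *. loop_elim y Hy.
      exists y; split; [easy|]. intros Hz Hlt. apply Hy. intros m Hm.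
      (* The value just tested at [i] is positive, which extends the invariant from [i] to [S i]. *)
      destruct (Nat.eq_dec m i) as [->|]; [eauto|]. apply Hlt; lia.
    + rewrite !Forall_app; repeat split; auto using del_rules_sound.
Qed.

(** * Completeness of the stack rewriting *)

Inductive rewrites (R : list oprule) : list op -> list op -> Prop :=
| rewrites_refl w : rewrites R w w
| rewrites_step x h t v y w :
    In (h, t, v) R -> rewrites R (x ++ v ++ y) w -> rewrites R (x ++ h :: t ++ y) w.

Lemma rewrites_trans R w1 w2 w3 :
  rewrites R w1 w2 -> rewrites R w2 w3 -> rewrites R w1 w3.
Proof. induction 1; [easy|]. intros; eapply rewrites_step; eauto. Qed.

Lemma rewrites_app_l R u w w' : rewrites R w w' -> rewrites R (u ++ w) (u ++ w').
Proof.
  induction 1; [constructor|]. rewrite app_assoc. eapply rewrites_step; [eassumption|].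
  rewrite <- app_assoc. exact IHrewrites.
Qed.

Definition stack (s : list nat) : list op :=
  flat_map (fun n => repeat Inc n ++ [Push]) s.

Definition runs (R : list oprule) (w : list op) (s s' : list nat) : Prop :=
  rewrites R (w ++ stack s) (stack s').

Lemma runs_app R u v s m s' : runs R v s m -> runs R u m s' -> runs R (u ++ v) s s'.
Proof.
  unfold runs; intros Hv Hu. rewrite <- app_assoc.
  eapply rewrites_trans; [apply rewrites_app_l, Hv|exact Hu].
Qed.

Lemma runs_cons R o v s m s' : runs R v s m -> runs R [o] m s' -> runs R (o :: v) s s'.
Proof. apply (runs_app R [o]). Qed.

Lemma runs_nil R s : runs R [] s s.
Proof. constructor. Qed.

Lemma runs_push R s : runs R [Push] s (0 :: s).
Proof. constructor. Qed.

Lemma runs_inc R x s : runs R [Inc] (x :: s) (S x :: s).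
Proof. constructor. Qed.

Lemma runs_rule R h v s s' : In (h, [], v) R -> runs R v s s' -> runs R [h] s s'.
Proof. intros Hr. apply (rewrites_step R [] h [] v), Hr. Qed.

Lemma runs_rule_push R h v s s' :
  In (h, [Push], v) R -> runs R v s s' -> runs R [h] (0 :: s) s'.
Proof. intros Hr. apply (rewrites_step R [] h [Push] v), Hr. Qed.

Lemma runs_rule_inc R h v x s s' :
  In (h, [Inc], v) R -> runs R v (x :: s) s' -> runs R [h] (S x :: s) s'.
Proof. intros Hr. apply (rewrites_step R [] h [Inc] v), Hr. Qed.

Ltac in_rules :=
  match goal with
  | H : incl ?l ?R |- In _ ?R => apply H; cbn; solve [intuition congruence]
  end.

Lemma runs_inc1 R x y s : incl base_rules R -> runs R [Inc1] (x :: y :: s) (x :: S y :: s).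
Proof.
  intros HR; induction x as [|x IH].
  - eapply runs_rule_push; [in_rules|]. eapply runs_cons; [apply runs_inc|apply runs_push].
  - eapply runs_rule_inc; [in_rules|]. eapply runs_cons; [apply IH|apply runs_inc].
Qed.

Lemma runs_ins1 R x s : incl base_rules R -> runs R [Ins1] (x :: s) (x :: 0 :: s).
Proof.
  intros HR; induction x as [|x IH].
  - eapply runs_rule_push; [in_rules|]. eapply runs_cons; apply runs_push.
  - eapply runs_rule_inc; [in_rules|]. eapply runs_cons; [apply IH|apply runs_inc].
Qed.

(** Outer induction on the index, inner induction on the top entry, which the rules take apart in
    unary. *)
Lemma runs_pick R i s :
  incl base_rules R -> incl (pick_rules i) R -> i < length s ->
  runs R [Pick i] s (nth i s 0 :: s).
Proof.
  intros HB; revert s; induction i as [|i IHi]; intros [|x s] HR Hi;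
    try (cbn in Hi; lia); induction x as [|x IHx]; cbn [nth] in *.
  - eapply runs_rule_push; [in_rules|]. eapply runs_cons; apply runs_push.
  - eapply runs_rule_inc; [in_rules|].
    eapply runs_cons; [|apply runs_inc]. eapply runs_cons; [|apply runs_inc1, HB].
    apply IHx; cbn in *; lia.
  - eapply runs_rule_push; [in_rules|].
    eapply runs_cons; [|apply runs_ins1, HB]. apply IHi; [|cbn in Hi; lia].
    intros r Hr; apply HR; right; right; exact Hr.
  - eapply runs_rule_inc; [in_rules|].
    eapply runs_cons; [|apply runs_inc1, HB]. apply IHx; cbn in *; lia.
Qed.

Lemma runs_del R i s :
  incl (del_rules i) R -> i < length s ->
  runs R [Del i] s (firstn i s ++ skipn (S i) s).
Proof.
  revert s; induction i as [|i IHi]; intros [|x s] HR Hi;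
    try (cbn in Hi; lia); induction x as [|x IHx].
  - eapply runs_rule_push; [in_rules|]. apply runs_nil.
  - eapply runs_rule_inc; [in_rules|]. apply IHx; cbn in *; lia.
  - eapply runs_rule_push; [in_rules|].
    eapply runs_cons; [|apply runs_push]. apply IHi; [|cbn in Hi; lia].
    intros r Hr; apply HR; right; right; exact Hr.
  - eapply runs_rule_inc; [in_rules|].
    eapply runs_cons; [|apply runs_inc]. apply IHx; cbn in *; lia.
Qed.

Ltac run_pick H :=
  match goal with
  | HB : incl base_rules ?R |- runs ?R [Pick ?i] ?s _ =>
      exact (runs_pick R i s HB H ltac:(cbn; lia))
  end.

Ltac run_del H :=
  match goal with
  | |- runs ?R [Del ?i] ?s _ => exact (runs_del R i s H ltac:(cbn; lia))
  end.

Definition args_rules (gs : list prf) (ds : list nat) : list oprule :=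
  (fix go gs ds :=
     match gs with
     | nil => nil
     | g :: gs => prf_rules g ds ++ go gs (map S ds)
     end) gs ds.

Definition bounded (ds s : list nat) : Prop := Forall (fun d => d < length s) ds.

Definition computes (R : list oprule) (f : prf) : Prop :=
  forall ds s y, incl (prf_rules f ds) R -> bounded ds s ->
    eval f (select s ds) y -> runs R [Fn f ds] s (y :: s).

Lemma bounded_shift k ds l s :
  length l = k -> bounded ds s -> bounded (map (fun d => k + d) ds) (l ++ s).
Proof.
  intros <- H; apply Forall_map. revert H; apply Forall_impl.
  intros d Hd; rewrite length_app; lia.
Qed.

Lemma select_shift k ds l s :
  length l = k -> select (l ++ s) (map (fun d => k + d) ds) = select s ds.
Proof.
  intros <-; unfold select; rewrite map_map. apply map_ext; intros d.
  rewrite app_nth2 by lia. f_equal; lia.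
Qed.

Lemma runs_args R gs ds s ys :
  Forall (computes R) gs -> incl (args_rules gs ds) R -> bounded ds s ->
  evall gs (select s ds) ys -> runs R (args gs ds) s (rev ys ++ s).
Proof.
  intros H; revert ds s ys; induction H as [|g gs Hg _ IH]; intros ds s ys HR Hb He;
    inversion He; subst; cbn [args rev app]; [constructor|].
  cbn in HR. apply incl_app_inv in HR as [HR1 HR2].
  eapply runs_app; [apply Hg; eassumption|]. rewrite <- app_assoc.
  apply IH; [exact HR2|exact (bounded_shift 1 ds [y] s eq_refl Hb)|].
  rewrite (select_shift 1 ds [y]); easy.
Qed.

Lemma runs_del_prefix R l y s :
  incl (del_rules 1) R ->
  runs R (repeat (Del 1) (length l)) (y :: l ++ s) (y :: s).
Proof.
  intros HR; induction l as [|x l IH]; [constructor|].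
  cbn [length repeat]. rewrite repeat_cons.
  eapply runs_app; [|exact IH].
  run_del HR.
Qed.

(** The loop computes upwards from 0 and thus needs all intermediate values to exist. *)
Lemma prim_defined f g k n v y :
  eval (Prim f g) (k + n :: v) y -> exists r, eval (Prim f g) (n :: v) r.
Proof.
  revert y; induction k as [|k IH]; intros y H; [eauto|].
  inversion H; subst; eauto.
Qed.

Lemma prf_computes R f : incl base_rules R -> computes R f.
Proof.
  intros HB; induction f as [| |i|f gs IHf IHgs|f g IHf IHg|f IHf] using prf_nested_ind;
    intros ds s y HR Hb He; cbn [prf_rules] in HR.
  - inversion He; subst. eapply runs_rule; [in_rules|]. apply runs_push.
  - destruct ds as [|d ds]; inversion He; subst. apply incl_cons_inv in HR as [HR HP].
    eapply runs_rule; [exact HR|].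
    eapply runs_cons; [|apply runs_inc]. inversion Hb; subst. now apply runs_pick.
  - inversion He as [| |? ? Hi| | | |]; subst.
    assert (Hi' : i < length ds) by (unfold select in Hi; now rewrite length_map in Hi).
    destruct (Nat.ltb_spec i (length ds)); [|lia].
    apply incl_cons_inv in HR as [HR HP]. eapply runs_rule; [exact HR|].
    replace (nth i (select s ds) 0) with (nth (nth i ds 0) s 0).
    + apply runs_pick; [easy|easy|].
      unfold bounded in Hb; rewrite Forall_forall in Hb. apply Hb, nth_In, Hi'.
    + symmetry; unfold select.
      rewrite nth_indep with (d' := nth 0 s 0) by (now rewrite length_map).
      apply (map_nth (fun i => nth i s 0)).
  - inversion He as [| | |? ? ? ys ? Hg Hf| | |]; subst.
    apply incl_cons_inv in HR as [HR HP].
    apply incl_app_inv in HP as [HD HP]. apply incl_app_inv in HP as [HPf HPg].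
    eapply runs_rule; [exact HR|]. unfold comp_word.
    pose proof (evall_length _ _ _ Hg) as Hl.
    apply runs_app with (m := y :: rev ys ++ s).
    + eapply runs_cons.
      * eapply runs_args; eauto.
      * apply IHf; [exact HPf| |].
        -- apply Forall_rev, Forall_forall. intros d Hd%in_seq.
           rewrite length_app, length_rev; lia.
        -- rewrite <- Hl, select_rev_seq; exact Hf.
    + rewrite <- Hl, <- length_rev. now apply runs_del_prefix.
  - destruct ds as [|d ds]; [inversion He|].
    apply incl_cons_inv in HR as [HR1 HR]. apply incl_cons_inv in HR as [HR2 HR].
    apply incl_cons_inv in HR as [HR3 HR].
    apply incl_app_inv in HR as [HP HR]. apply incl_app_inv in HR as [HP2 HR].
    apply incl_app_inv in HR as [HD0 HR]. apply incl_app_inv in HR as [HD3 HR].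
    apply incl_app_inv in HR as [HPf HPg].
    inversion Hb as [|? ? Hd Hb']; subst.
    set (v := select s ds) in *.
    cbn [select map] in He. fold (select s ds) in He. fold v in He.
    assert (Hloop : forall r i a, eval (Prim f g) (i :: v) a ->
      eval (Prim f g) (r + i :: v) y -> runs R [LoopP f g ds] (r :: i :: a :: s) (y :: s)).
    { induction r as [|r IHr]; intros i a Ha Hy.
      - eapply runs_rule_push; [exact HR2|]. rewrite (eval_fun _ _ _ _ Hy Ha).
        run_del HD0.
      - eapply runs_rule_inc; [exact HR3|].
        replace (S r + i) with (r + S i) in Hy by lia.
        (* The recursion is defined at [S i] because it is at [r + S i]; by determinism its value at
           [i] there is [a]. *)
        assert (exists a', eval g (i :: a :: v) a') as [a' Ha'].
        { destruct (prim_defined _ _ _ _ _ _ Hy) as [z Hz].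
          inversion Hz; subst. erewrite eval_fun with (y := a); eauto. }
        unfold prim_step.
        eapply runs_cons; [|apply (IHr (S i) a'); [econstructor; eauto|exact Hy]].
        (* The stacks are listed backwards, from the one handed to the next iteration down to the
           call of [g]. *)
        apply runs_cons with (m := r :: S i :: a' :: i :: s).
        2: run_del HD3.
        apply runs_cons with (m := r :: S i :: a' :: r :: i :: s).
        2: run_del HD3.
        apply runs_cons with (m := S i :: a' :: r :: i :: s).
        2: run_pick HP2.
        eapply runs_cons; [|apply runs_inc].
        apply runs_cons with (m := a' :: r :: i :: s).
        2: run_pick HP2.
        apply runs_cons with (m := a' :: r :: i :: a :: s).
        2: run_del HD3.
        apply IHg; [exact HPg| |].
        + constructor; [cbn; lia|]. constructor; [cbn; lia|].
          exact (bounded_shift 3 ds [r; i; a] s eq_refl Hb').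
        + change (eval g (i :: a :: select ([r; i; a] ++ s) (map (fun d => 3 + d) ds)) a').
          rewrite select_shift; easy. }
    destruct (prim_defined f g (nth d s 0) 0 v y) as [a Ha]; [now rewrite Nat.add_0_r|].
    eapply runs_rule; [exact HR1|].
    apply runs_cons with (m := nth d s 0 :: 0 :: a :: s).
    + apply runs_cons with (m := 0 :: a :: s); [|run_pick HP].
      apply runs_cons with (m := a :: s); [|apply runs_push].
      apply IHf; [exact HPf|exact Hb'|]. now inversion Ha.
    + apply Hloop; [exact Ha|now rewrite Nat.add_0_r].
  - apply incl_cons_inv in HR as [HR1 HR]. apply incl_cons_inv in HR as [HR2 HR].
    apply incl_cons_inv in HR as [HR3 HR]. apply incl_cons_inv in HR as [HR4 HR].
    apply incl_app_inv in HR as [HD HP].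
    inversion He as [| | | | | |? ? ? H0 Hlt]; subst.
    assert (Htest : forall i z s', eval f (i :: select s ds) z ->
      runs R [TestM f ds] (z :: i :: s) s' -> runs R [LoopM f ds] (i :: s) s').
    { intros i z s' Hz Ht. eapply runs_rule; [exact HR2|].
      eapply runs_cons; [|exact Ht]. apply IHf; [exact HP| |].
      - constructor; [cbn; lia|]. exact (bounded_shift 1 ds [i] s eq_refl Hb).
      - change (eval f (i :: select ([i] ++ s) (map (fun d => 1 + d) ds)) z).
        rewrite select_shift; easy. }
    (* Induction on the distance [k] from [i] to the least zero [y]. *)
    assert (Hloop : forall k i, i + k = y -> runs R [LoopM f ds] (i :: s) (y :: s)).
    { induction k as [|k IHk]; intros i Hi.
      - replace i with y by lia. eapply Htest; [exact H0|].
        eapply runs_rule_push; [exact HR3|]. apply runs_nil.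
      - destruct (Hlt i) as [z Hz]; [lia|]. eapply Htest; [exact Hz|].
        eapply runs_rule_inc; [exact HR4|].
        apply runs_cons with (m := S i :: s); [|apply IHk; lia].
        apply runs_cons with (m := i :: s); [|apply runs_inc].
        run_del HD. }
    eapply runs_rule; [exact HR1|].
    apply runs_cons with (m := 0 :: s); [apply runs_push|]. now apply (Hloop y).
Qed.

(** * From stack rewriting to queue rewriting *)

Lemma to_nat_inj2 a b a' b' :
  Cantor.to_nat (a, b) = Cantor.to_nat (a', b') -> a = a' /\ b = b'.
Proof. intros H%Cantor.to_nat_inj; now injection H. Qed.

(** Operations must become letters, which are numbers; all that is used of this numbering is its
    injectivity. *)
Fixpoint prf_code (f : prf) : nat :=
  match f with
  | Zero => Cantor.to_nat (0, 0)
  | Succ => Cantor.to_nat (1, 0)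
  | Proj i => Cantor.to_nat (2, i)
  | Comp f gs =>
      Cantor.to_nat (3, Cantor.to_nat (prf_code f,
        (fix go l := match l with
                     | nil => 0
                     | g :: l => S (Cantor.to_nat (prf_code g, go l))
                     end) gs))
  | Prim f g => Cantor.to_nat (4, Cantor.to_nat (prf_code f, prf_code g))
  | Mu f => Cantor.to_nat (5, prf_code f)
  end.

Ltac code_inj :=
  repeat match goal with
    | H : Cantor.to_nat (_, _) = Cantor.to_nat (_, _) |- _ =>
        apply to_nat_inj2 in H as [? ?]
    end.

Lemma prf_code_inj f f' : prf_code f = prf_code f' -> f = f'.
Proof.
  revert f'; induction f as [| |i|f gs IHf IHgs|f g IHf IHg|f IHf] using prf_nested_ind;
    intros [| |j|f' gs'|f' g'|f']; cbn [prf_code]; intros H; code_inj;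
    try discriminate; try easy; try (f_equal; auto; fail).
  f_equal; [auto|].
  match goal with H : _ gs = _ gs' |- _ => revert gs' H end.
  induction IHgs as [|g gs Hg _ IH]; intros [|g' gs'] Hs; try easy.
  apply Nat.succ_inj in Hs; code_inj. f_equal; auto.
Qed.

Fixpoint nats_code (l : list nat) : nat :=
  match l with
  | nil => 0
  | x :: l => S (Cantor.to_nat (x, nats_code l))
  end.

Lemma nats_code_inj l l' : nats_code l = nats_code l' -> l = l'.
Proof.
  revert l'; induction l as [|x l IH]; intros [|x' l']; cbn [nats_code]; try easy.
  intros H%Nat.succ_inj; code_inj. f_equal; auto.
Qed.

(* 0 and 1 are reserved for the final letter and the end marker. *)
Definition op_code (o : op) : nat :=
  2 + Cantor.to_nat
    match o with
    | Inc => (0, 0)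
    | Push => (0, 1)
    | Inc1 => (0, 2)
    | Ins1 => (0, 3)
    | Pick i => (1, i)
    | Del i => (2, i)
    | Fn f ds => (3, Cantor.to_nat (prf_code f, nats_code ds))
    | LoopP f g ds => (4, Cantor.to_nat (prf_code f, Cantor.to_nat (prf_code g, nats_code ds)))
    | LoopM f ds => (5, Cantor.to_nat (prf_code f, nats_code ds))
    | TestM f ds => (6, Cantor.to_nat (prf_code f, nats_code ds))
    end.

Lemma op_code_inj o o' : op_code o = op_code o' -> o = o'.
Proof.
  intros H; apply Nat.add_cancel_l in H.
  destruct o, o'; code_inj; try discriminate; f_equal; auto using prf_code_inj, nats_code_inj.
Qed.

Definition word_code : list op -> list nat := map op_code.

Lemma word_code_app u v : word_code (u ++ v) = word_code u ++ word_code v.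
Proof. apply map_app. Qed.

Definition stack_rules (g : prf) : list oprule := base_rules ++ prf_rules g [0].

(** These are the letters that a run can put on the ring, and the ones that get rotation rules. *)
Definition alphabet (g : prf) : list nat :=
  1 :: word_code (Inc :: Push :: Fn g [0] :: flat_map snd (stack_rules g)).

Definition rule_of (r : oprule) : rule :=
  Rule (op_code (fst (fst r))) (word_code (snd (fst r))) 0 (word_code (snd r)).

(** The first three rules erase a finished stack behind the marker 1 and halt when only the marker
    is left. *)
Definition machine (g : prf) : list rule :=
  [ Rule 1 [op_code Inc] 0 [1]; Rule 1 [op_code Push] 0 [1]; Rule 1 [] 1 [0] ]
    ++ map rule_of (stack_rules g) ++ map (fun a => Rule a [] 0 [a]) (alphabet g).

Definition start (g : prf) : list nat := [1; op_code (Fn g [0])].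
Definition input (n : nat) : list nat := word_code (stack [n]).

Lemma accepts_rotate g w1 w2 :
  incl w1 (alphabet g) -> accepts (machine g) (w2 ++ w1) 0 ->
  accepts (machine g) (w1 ++ w2) 0.
Proof.
  revert w2; induction w1 as [|a w1 IH]; intros w2 Ha H; [now rewrite app_nil_r in H|].
  apply incl_cons_inv in Ha as [Ha Hw].
  apply (accepts_step _ (Rule a [] 0 [a])).
  - unfold machine; rewrite !in_app_iff. right; right.
    apply (in_map (fun a => Rule a [] 0 [a])), Ha.
  - cbn. rewrite <- app_assoc. apply IH; [exact Hw|]. now rewrite <- app_assoc.
Qed.

(** Rotating the marker and [x] away puts [h :: t] in front; the rule appends [v], and rotating [y]
    restores the ring. *)
Lemma accepts_rewrites g w w' :
  rewrites (stack_rules g) w w' -> incl (word_code w) (alphabet g) ->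
  accepts (machine g) (1 :: word_code w') 0 -> accepts (machine g) (1 :: word_code w) 0.
Proof.
  induction 1 as [|x h t v y w Hr _ IH]; intros Hw Ha; [easy|].
  rewrite app_comm_cons, !word_code_app in Hw |- *.
  apply incl_app_inv in Hw as [Hx Hy]. apply incl_app_inv in Hy as [_ Hy].
  assert (Hv : incl (word_code v) (alphabet g)).
  { apply incl_tl, incl_map. do 3 apply incl_tl. intros o Ho.
    apply in_flat_map. exists (h, t, v); auto. }
  assert (H1x : incl (1 :: word_code x) (alphabet g)) by (apply incl_cons; [now left|easy]).
  rewrite !word_code_app in IH.
  specialize (IH ltac:(repeat apply incl_app; assumption) Ha).
  apply (accepts_rotate g (1 :: word_code x)); [exact H1x|].
  cbn [app]. rewrite <- app_assoc.
  apply (accepts_step _ (rule_of (h, t, v))).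
  - unfold machine; rewrite !in_app_iff. right; left. now apply in_map.
  - cbn. rewrite <- app_assoc.
    apply accepts_rotate; [exact Hy|]. cbn [app]. rewrite <- app_assoc. exact IH.
Qed.

Lemma accepts_clean g w :
  Forall (fun o => o = Inc \/ o = Push) w -> accepts (machine g) (1 :: word_code w) 0.
Proof.
  induction 1 as [|o w Ho Hw IH]; cbn [word_code map].
  - apply (accepts_step _ (Rule 1 [] 1 [0])); [cbn; auto|constructor].
  - assert (Hi : incl (word_code w) (alphabet g)).
    { apply incl_tl, incl_map. intros p Hp. rewrite Forall_forall in Hw.
      destruct (Hw p Hp) as [->| ->]; cbn; auto. }
    apply (accepts_step _ (Rule 1 [op_code o] 0 [1])).
    + destruct Ho as [->| ->]; cbn; auto.
    + cbn. now apply accepts_rotate.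
Qed.

Lemma stack_ops s : Forall (fun o => o = Inc \/ o = Push) (stack s).
Proof.
  apply Forall_forall. intros o (x & _ & Ho)%in_flat_map.
  apply in_app_iff in Ho as [->%repeat_spec|[<-|[]]]; auto.
Qed.

Lemma machine_complete g n y :
  eval g [n] y -> accepts (machine g) (start g ++ input n) 0.
Proof.
  intros H. apply (accepts_rewrites g (Fn g [0] :: stack [n]) (stack [y; n])).
  - apply (prf_computes (stack_rules g) g); [intros r Hr; apply in_app_iff; auto..| |exact H].
    constructor; [cbn; lia|constructor].
  - apply incl_tl, incl_map. intros o [<-|Ho]; [cbn; auto|].
    pose proof (stack_ops [n]) as Hs; rewrite Forall_forall in Hs.
    destruct (Hs o Ho) as [->| ->]; cbn; auto.
  - apply accepts_clean, stack_ops.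
Qed.

(** * Soundness of the queue machine *)

(** The ring is cut at the marker 1 and read as a stack program. *)
Definition good (w : list nat) : Prop :=
  exists w1 w2 s, w = word_code w1 ++ 1 :: word_code w2 /\ word_rel (w2 ++ w1) [] s.

(** The second case is the halting rule. In the first, a 0 in [w ++ rhs r] must come from [w], which
    handles the words with a 0 added in [letter_lang]. *)
Definition rule_sound (r : rule) : Prop :=
  tgt r = 0 /\ ~ In 0 (rhs r) /\
    (forall w, good (w ++ rhs r) -> good (lhd r :: ltl r ++ w)) \/
  tgt r = 1 /\ rhs r = [0] /\ good (lhd r :: ltl r).

Lemma word_code_inj w w' : word_code w = word_code w' -> w = w'.
Proof.
  revert w'; induction w as [|o w IH]; intros [|o' w']; try easy.
  intros H; f_equal.
  - exact (op_code_inj _ _ (f_equal (hd 0) H)).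
  - exact (IH _ (f_equal (@tl nat) H)).
Qed.

Lemma marker_word w : ~ In 1 (word_code w).
Proof. intros (o & Ho & _)%in_map_iff. discriminate Ho. Qed.

Lemma final_word w : ~ In 0 (word_code w).
Proof. intros (o & Ho & _)%in_map_iff. discriminate Ho. Qed.

Lemma marker_split w v w1 w2 :
  w ++ word_code v = word_code w1 ++ 1 :: word_code w2 ->
  exists w2', w2 = w2' ++ v /\ w = word_code w1 ++ 1 :: word_code w2'.
Proof.
  revert w1; induction w as [|a w IH]; intros w1; cbn [app].
  - intros H; destruct (marker_word v). rewrite H. apply in_elt.
  - destruct w1 as [|o w1]; cbn [word_code map app]; intros [= -> H].
    + symmetry in H. apply map_eq_app in H as (l1 & l2 & -> & <- & H).
      apply word_code_inj in H as ->. eauto.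
    + apply IH in H as (w2' & -> & ->). eauto.
Qed.

(** Read from the marker on, the rings before and after the step differ only by [h :: t] and [v] at
    the same place. *)
Lemma oprule_of_sound r : oprule_sound r -> rule_sound (rule_of r).
Proof.
  intros Hr; left; split; [easy|split; [apply final_word|]].
  intros w (w1 & w2 & s & Hw & H). cbn [rhs rule_of] in Hw.
  apply marker_split in Hw as (w2' & -> & ->).
  exists (fst (fst r) :: snd (fst r) ++ w1), w2', s. split.
  - cbn. unfold word_code. rewrite map_app, <- app_assoc. easy.
  - rewrite <- app_assoc in H. rewrite app_comm_cons.
    rewrite !word_rel_app in H |- *. destruct H as (m & H & H').
    exists m; split; [|exact H']. rewrite word_rel_app in H |- *.
    destruct H as (m' & H & Hm). eauto.
Qed.

(** With the marker at the end, all of [w] is the program; before the step it is [u] acting after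
    [w], and [u] always has a result. *)
Lemma marker_rule_sound u :
  (forall s, exists s', word_rel u s s') -> rule_sound (Rule 1 (word_code u) 0 [1]).
Proof.
  intros Hu; left; split; [easy|split; [cbn; lia|]]. cbn [lhd ltl rhs].
  intros w (w1 & w2 & s & Hw & H).
  destruct w2 as [|o w2 _] using rev_ind.
  - change (word_code []) with (@nil nat) in Hw.
    apply app_inj_tail in Hw as [-> _]. cbn [app] in H.
    destruct (Hu s) as [s' Hs]. exists [], (u ++ w1), s'. split.
    + cbn. unfold word_code; now rewrite map_app.
    + rewrite app_nil_r, word_rel_app; eauto.
  - unfold word_code in Hw. rewrite map_app, app_comm_cons, app_assoc in Hw.
    apply app_inj_tail in Hw as [_ Hw]. discriminate Hw.
Qed.

Lemma machine_sound g : Forall rule_sound (machine g).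
Proof.
  unfold machine. rewrite !Forall_app; repeat split.
  - constructor; [|constructor; [|constructor; [|constructor]]].
    + apply (marker_rule_sound [Inc]). intros s; eexists; cbn; eauto.
    + apply (marker_rule_sound [Push]). intros s; eexists; cbn; eauto.
    + right; split; [easy|split; [easy|]]. exists [], [], []; easy.
  - apply Forall_map. unfold stack_rules. apply Forall_app; split.
    + eapply Forall_impl; [apply oprule_of_sound|apply base_rules_sound].
    + eapply Forall_impl; [apply oprule_of_sound|apply prf_rules_sound].
  - apply Forall_map. constructor.
    + apply (marker_rule_sound []). intros s; eexists; cbn; eauto.
    + apply Forall_map, Forall_forall. intros o _.
      apply (oprule_of_sound (o, [], [o])). intros s s' H; exact H.
Qed.

Lemma good_start g n : good (start g ++ input n) -> exists y, eval g [n] y.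
Proof.
  intros ([|o w1] & w2 & s & Hw & H); [|discriminate Hw].
  injection Hw as Hw.
  change (word_code (Fn g [0] :: stack [n]) = word_code w2) in Hw.
  apply word_code_inj in Hw as <-. rewrite app_nil_r in H.
  destruct H as (m & H & y & -> & Hy). exists y.
  assert (m = [n]) as ->; [|exact Hy].
  clear - H. revert m H; induction n as [|n IH]; cbn.
  - intros m (m' & -> & ->); easy.
  - intros m (m' & H & ->). rewrite (IH m' H); easy.
Qed.

(** * Query sequents and their reading in the language model *)

Definition query (R : list rule) (w u : list nat) : sequent :=
  Seq (Meta [] (map TF (letters w) ++ bangs (program R))) (overs (Var 0) (letters u)).

(** Adding all words with a 0 to the language of [s] makes the halting rule sound: its
    premise [w 0] is in the language of [t] also for words [w] starting with 0. *)
Definition letter_lang (n : nat) (w : list nat) : Prop :=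
  match n with
  | 0 => In 0 w \/ good w
  | 1 => exists u, w = 0 :: u
  | 2 => w = []
  | S (S (S a)) => w = [a]
  end.

(** A token denotes only the empty word and a letter only its one-letter word, so the divisions
    prescribe the continuation [u]. *)
Lemma den_overs_letters C u w :
  den letter_lang (overs C (letters u)) w <-> den letter_lang C (w ++ u).
Proof.
  revert w; induction u as [|a u IH]; intros w; [now rewrite app_nil_r|].
  change (w ++ a :: u) with (w ++ [a] ++ u). rewrite app_assoc, <- IH. split.
  - intros H. specialize (H [] eq_refl [a] eq_refl). now rewrite app_nil_r in H.
  - intros H x -> y ->. now rewrite app_nil_r.
Qed.

Lemma den_letters w : den_seq letter_lang (map TF (letters w)) w.
Proof.
  induction w as [|a w IH]; [easy|].
  exists [], (a :: w); split; [easy|split; [reflexivity|]].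
  exists [a], w; split; [easy|split; [reflexivity|exact IH]].
Qed.

Lemma rule_formula_den r : rule_sound r -> den letter_lang (rule_formula r) [].
Proof.
  intros Hr u Hu; cbn in Hu; subst u. cbn [app den].
  unfold action. intros x Hx; cbn in Hx; subst x; cbn [app].
  apply den_overs_letters. intros w Hw. apply den_overs_letters in Hw.
  cbn [app]. destruct Hr as [(Ht & H0 & Hr)|(Ht & H0 & Hr)]; rewrite Ht in Hw.
  - destruct Hw as [Hw|Hw]; [|right; exact (Hr _ Hw)].
    left. apply in_app_iff in Hw as [Hw|Hw]; [|easy]. right. apply in_app_iff; auto.
  - rewrite H0 in Hw. destruct Hw as [u Hw]. destruct w as [|a w].
    + right. rewrite app_nil_r. exact Hr.
    + injection Hw as -> _. left. right. apply in_elt.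
Qed.

(** The words beginning with 0 are closed under extension to the right, so division by the rule
    formulae keeps them, whatever these denote. *)
Lemma collector_den R : den letter_lang (collector R) [].
Proof.
  unfold collector, overs. rewrite fold_right_app.
  apply (den_overs_letters (overs (Var 1) (map rule_formula R)) [0] []).
  assert (H : forall u, den letter_lang (overs (Var 1) (map rule_formula R)) (0 :: u)).
  { induction R as [|r R IH]; intros u; [cbn; eauto|]. intros v _. apply IH. }
  apply H.
Qed.

Definition valid (s : sequent) : Prop :=
  forall X (V : nat -> list X -> Prop) w, den_meta V (ant s) w -> den V (suc s) w.

Lemma query_good R w u :
  Forall rule_sound R -> ~ In 0 (w ++ u) -> valid (query R w u) -> good (w ++ u).
Proof.
  intros HR H0 H. specialize (H nat letter_lang w). cbn [ant suc query] in H.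
  rewrite den_overs_letters in H. destruct H as [H|H]; [|easy|exact H].
  apply den_metaE; split; [constructor|].
  apply den_seq_app_intro with w []; [apply den_letters| |now rewrite app_nil_r].
  assert (HZ : Forall (fun A => den letter_lang A []) (program R)).
  { constructor; [apply collector_den|]. apply Forall_map.
    eapply Forall_impl; [apply rule_formula_den|exact HR]. }
  induction HZ as [|A Z HA _ IH]; [easy|]. exists [], []; repeat split; auto.
Qed.

Lemma F_query b R w u :
  accepts R (w ++ u) 0 -> derivF b (query R w u).
Proof.
  intros H%(F_accepts b). apply F_oversR; [now destruct (map TF (letters w))|].
  rewrite letters_app, map_app, <- app_assoc in H. rewrite <- app_assoc.
  pose proof (F_bangs_swap b (program R) (map TF (letters w)) (map TF (letters u)) []
    (Var 0)) as Hs.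
  rewrite !app_nil_r in Hs. apply Hs, H.
Qed.

Lemma M_bangsL v Z z G C :
  derivM v (Seq (Meta (z ++ Z) G) C) -> derivM v (Seq (Meta z (G ++ bangs Z)) C).
Proof.
  revert z; induction Z as [|A Z IH]; intros z H; cbn [bangs map].
  - now rewrite !app_nil_r in *.
  - apply (M_bangL v Hole). apply IH. now rewrite <- app_assoc.
Qed.

Lemma M_query v R w u :
  accepts R (w ++ u) 0 -> derivM v (query R w u).
Proof.
  intros H%(M_accepts v). apply (M_bangsL v (program R) []). apply M_oversR; [easy|].
  now rewrite letters_app, map_app in H.
Qed.

Lemma query_in_fragment R w u : in_fragment (query R w u).
Proof.
  split.
  - cbn [query ant all_meta forallb andb].
    assert (H : forallb onediv (letters w ++ map Bang (program R)) = true).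
    { rewrite forallb_app, letters_onediv. cbn [andb].
      pose proof (program_onediv R) as H. induction (program R); [easy|].
      cbn in *. apply Bool.andb_true_iff in H as [-> H]. auto. }
    unfold bangs. rewrite <- (map_map Bang TF), <- map_app.
    induction (letters w ++ map Bang (program R)); [easy|].
    cbn in *. apply Bool.andb_true_iff in H as [-> H]. auto.
  - cbn [query suc]. apply overs_onediv; [easy|apply letters_onediv].
Qed.

Lemma query_stoup_free R w u : stoup_free (query R w u).
Proof.
  unfold stoup_free. cbn [query ant sfree_meta andb].
  unfold bangs. rewrite <- (map_map Bang TF), <- map_app.
  induction (letters w ++ map Bang (program R)); easy.
Qed.

(** * Diagonalization *)

Lemma eval_comp1 f g v x y : eval g v x -> eval f [x] y -> eval (Comp f [g]) v y.
Proof. intros; econstructor; [repeat constructor|]; eassumption. Qed.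

Lemma eval_comp2 f g h v x1 x2 y :
  eval g v x1 -> eval h v x2 -> eval f [x1; x2] y -> eval (Comp f [g; h]) v y.
Proof. intros; econstructor; [repeat constructor|]; eassumption. Qed.

Lemma eval_proj i v x : nth_error v i = Some x -> eval (Proj i) v x.
Proof.
  intros H. rewrite <- (nth_error_nth v i 0 H). constructor.
  apply nth_error_Some; congruence.
Qed.

Definition const_prf (c : nat) : prf := Nat.iter c (fun f => Comp Succ [f]) Zero.

Lemma eval_const c v : eval (const_prf c) v c.
Proof. induction c; [constructor|]. eapply eval_comp1; [exact IHc|constructor]. Qed.

Definition add_prf : prf := Prim (Proj 0) (Comp Succ [Proj 1]).

Lemma eval_add a b : eval add_prf [a; b] (a + b).
Proof.
  induction a as [|a IH].
  - apply ePrim0, eval_proj; easy.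
  - apply ePrimS with (1 := IH). eapply eval_comp1; [now apply eval_proj|constructor].
Qed.

(** The division by two in [cpair] is avoided by summing up triangular numbers. *)
Fixpoint triangle (n : nat) : nat :=
  match n with 0 => 0 | S m => triangle m + S m end.

Lemma triangleE n : n * (n + 1) / 2 = triangle n.
Proof.
  assert (H : n * (n + 1) = triangle n * 2) by (induction n; cbn; lia).
  rewrite H. apply Nat.div_mul; easy.
Qed.

Definition triangle_prf : prf := Prim Zero (Comp add_prf [Proj 1; Comp Succ [Proj 0]]).

Lemma eval_triangle n : eval triangle_prf [n] (triangle n).
Proof.
  induction n as [|n IH]; [repeat constructor|].
  apply ePrimS with (1 := IH).
  eapply eval_comp2; [now apply eval_proj| |apply eval_add].
  eapply eval_comp1; [now apply eval_proj|constructor].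
Qed.

Definition cpair_prf (g h : prf) : prf :=
  Comp (Comp add_prf [Comp triangle_prf [add_prf]; Proj 1]) [g; h].

Lemma eval_cpair g h v a b :
  eval g v a -> eval h v b -> eval (cpair_prf g h) v (cpair a b).
Proof.
  intros Ha Hb. eapply eval_comp2; [exact Ha|exact Hb|].
  unfold cpair. rewrite triangleE.
  eapply eval_comp2; [|now apply eval_proj|apply eval_add].
  eapply eval_comp1; [apply eval_add|apply eval_triangle].
Qed.

Definition input_goal (n : nat) : formula := overs (Var 0) (letters (input n)).

(** First letters are outermost in [overs], so one more [Inc] wraps the goal in two divisions; 3 is
    the tag of [Over] in [code_f]. *)
Definition input_code_prf : prf :=
  Prim (const_prf (code_f (input_goal 0)))
    (cpair_prf (const_prf 3)
       (cpair_prf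
          (cpair_prf (const_prf 3)
             (cpair_prf (Proj 1) (const_prf (code_f (letter_var (op_code Inc))))))
          (const_prf (code_f token)))).

Lemma input_goal_S n :
  input_goal (S n) = Over (Over (input_goal n) (letter_var (op_code Inc))) token.
Proof. reflexivity. Qed.

Lemma eval_input_code n : eval input_code_prf [n] (code_f (input_goal n)).
Proof.
  induction n as [|n IH]; [apply ePrim0, eval_const|].
  apply ePrimS with (1 := IH). rewrite input_goal_S. cbn [code_f].
  repeat apply eval_cpair; try apply eval_const. now apply eval_proj.
Qed.

(** [Proj 1] skips the search variable, so the searched function is constant: there is a value
    exactly when [f] answers 0. *)
Definition diagonal (f : prf) : prf :=
  Mu (Comp f [cpair_prf (Proj 1) (Comp input_code_prf [Proj 1])]).

Lemma eval_diagonal f x :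
  (exists y, eval (diagonal f) [x] y) <-> eval f [cpair x (code_f (input_goal x))] 0.
Proof.
  assert (H : forall m, eval (cpair_prf (Proj 1) (Comp input_code_prf [Proj 1])) [m; x]
                          (cpair x (code_f (input_goal x)))).
  { intros m. apply eval_cpair; [now apply eval_proj|].
    eapply eval_comp1; [now apply eval_proj|apply eval_input_code]. }
  split.
  - intros [y Hy]. inversion Hy as [| | | | | |? ? ? H0 _]; subst.
    inversion H0 as [| | |? ? ? ys ? Hg Hf| | |]; subst.
    inversion Hg as [|? ? ? z zs Hz Hzs]; subst. inversion Hzs; subst.
    rewrite (eval_fun _ _ _ _ (H y) Hz). exact Hf.
  - intros Hf. exists 0. apply eMu; [|lia]. eapply eval_comp1; [apply H|exact Hf].
Qed.

Lemma code_query R w u :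
  code (query R w u) =
  cpair (code_meta (ant (query R w []))) (code_f (overs (Var 0) (letters u))).
Proof. reflexivity. Qed.

(** Any relation between acceptance and validity will do, so all five calculi are handled at
    once. *)
Lemma undecidable_on_queries (In' D : sequent -> Prop) :
  (forall R w u, In' (query R w u)) ->
  (forall R w u, accepts R (w ++ u) 0 -> D (query R w u)) ->
  (forall s, D s -> valid s) ->
  undecidable_on In' D.
Proof.
  intros HIn Hacc Hval [f Hf].
  set (g := diagonal f).
  enough (H : forall x, x = code_meta (ant (query (machine g) (start g) [])) -> False)
    by exact (H _ eq_refl).
  (* A generic [x] keeps conversion from evaluating the code of the program. *)
  intros x Hx.
  pose proof (code_query (machine g) (start g) (input x)) as Hs.
  rewrite <- Hx in Hs.
  destruct (Hf _ (HIn (machine g) (start g) (input x))) as [[HD H1]|[HD H0]];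
    rewrite Hs in *.
  (* If the query is derivable, the diagonal program halts, so [f] answers 0 besides 1. *)
  - apply Hval, query_good, good_start, eval_diagonal in HD.
    + discriminate (eval_fun _ _ _ _ H1 HD).
    + apply machine_sound.
    + intros [H|[H|H]]; [discriminate H|discriminate H|]. exact (final_word _ H).
  (* If [f] answers 0, the diagonal program halts, and acceptance makes the query derivable. *)
  - apply eval_diagonal in H0 as [y Hy]. apply HD, Hacc, (machine_complete g x y Hy).
Qed.

Theorem theorem15 :
  undecidable_on (fun s => in_fragment s /\ stoup_free s) (derivF false)   (* F_2018 *)
  /\ undecidable_on (fun s => in_fragment s /\ stoup_free s) (derivF true) (* F^-_2018 *)
  /\ undecidable_on in_fragment (derivM M'2018)                            (* M'_2018 *)
  /\ undecidable_on in_fragment (derivM M'm2018)                           (* M'^-_2018 *)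
  /\ undecidable_on in_fragment (derivM M2018).                            (* M_2018 *)
Proof.
  repeat split; apply undecidable_on_queries;
    auto using query_in_fragment, query_stoup_free, F_query, M_query;
    intros s Hs X V; eauto using derivF_sound, derivM_sound.
Qed.
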